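(* The parameterized problem \textsc{LS-Vertex Cover} is $\mathrm{W}[1]$-hard (with respect to parameterized reductions) when restricted to instances whose graph is $2$-subdivided.
   Context: All graphs are finite, undirected and simple. A set $S\subseteq V$ is a vertex cover of $G=(V,E)$ if every edge has an endpoint in $S$. For sets $S_1,S_2$, $\mathrm{dist}(S_1,S_2)=|S_1\cup S_2|-|S_1\cap S_2|$; $S_1$ is in the $k$-exchange neighborhood of $S_2$ if $\mathrm{dist}(S_1,S_2)\le k$. \textsc{LS-Vertex Cover}: the input is a graph $G=(V,E)$, a vertex cover $S\subseteq V$ of $G$, and an integer $k$; the parameter is $k$; the question is whether there is a vertex cover $S'\subseteq V$ of $G$ with $\mathrm{dist}(S,S')\le k$ and $|S'|<|S|$. Subdividing an edge $xy$ twice means removing $xy$ and adding two new vertices $z,z'$ and edges $xz$, $zz'$, $z'y$. A graph is $2$-subdivided if it can be obtained from some graph by subdividing every edge twice. *)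

(* Defs.v *)
From mathcomp Require Import all_boot.

Set Implicit Arguments.
Unset Strict Implicit.
Unset Printing Implicit Defensive.

(** * Model of computation

    N. D. Jones' WHILE language over binary trees.  Every assignment and every
    test costs one unit; since the expressions of a fixed program have bounded
    size, this is Jones' cost measure up to a constant factor.

    The model is polynomially equivalent to multitape Turing machines: an
    implementation with shared subtrees allocates O(1) cells per step.  A tree
    value may be exponentially larger than the running time, but below inputs
    and outputs are always (pairs of) lists of atoms, and these cannot: the
    depth of the values grows by at most a constant per step. *)

Inductive tree := Nil | Cons of tree & tree.

Definition hd (d : tree) : tree := if d is Cons a _ then a else Nil.
Definition tl (d : tree) : tree := if d is Cons _ b then b else Nil.
Definition truthy (d : tree) : bool := if d is Cons _ _ then true else false.

Inductive expr :=
  | EVar of nat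
  | ENil
  | ECons of expr & expr
  | EHd of expr
  | ETl of expr.

Inductive cmd :=
  | Assign of nat & expr
  | Seq of cmd & cmd
  | If of expr & cmd & cmd
  | While of expr & cmd.

Definition store := nat -> tree.

Definition update (s : store) (v : nat) (d : tree) : store :=
  fun w => if w == v then d else s w.

Fixpoint eval (s : store) (e : expr) : tree :=
  match e with
  | EVar v => s v
  | ENil => Nil
  | ECons e1 e2 => Cons (eval s e1) (eval s e2)
  | EHd e1 => hd (eval s e1)
  | ETl e1 => tl (eval s e1)
  end.

(* [exec c s t s']: started in [s], [c] halts in [s'] after exactly [t] units
   of time. *)
Inductive exec : cmd -> store -> nat -> store -> Prop :=
  | ExecAssign v e s :
      exec (Assign v e) s 1 (update s v (eval s e))
  | ExecSeq c1 c2 s s1 s2 t1 t2 :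
      exec c1 s t1 s1 -> exec c2 s1 t2 s2 -> exec (Seq c1 c2) s (t1 + t2) s2
  | ExecIfTrue e c1 c2 s s1 t :
      truthy (eval s e) -> exec c1 s t s1 -> exec (If e c1 c2) s t.+1 s1
  | ExecIfFalse e c1 c2 s s1 t :
      ~~ truthy (eval s e) -> exec c2 s t s1 -> exec (If e c1 c2) s t.+1 s1
  | ExecWhileTrue e c s s1 s2 t1 t2 :
      truthy (eval s e) -> exec c s t1 s1 -> exec (While e c) s1 t2 s2 ->
      exec (While e c) s (t1 + t2).+1 s2
  | ExecWhileFalse e c s :
      ~~ truthy (eval s e) -> exec (While e c) s 1 s.

(* Variable 0 holds the input and the output; all others start as [Nil]. *)
Definition runs (p : cmd) (input : tree) (t : nat) (output : tree) : Prop :=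
  exists2 s, exec p (update (fun _ => Nil) 0 input) t s & s 0 = output.

Definition tree_of_bool (b : bool) : tree := if b then Cons Nil Nil else Nil.

Definition tree_of_bits (x : seq bool) : tree :=
  foldr (fun b d => Cons (tree_of_bool b) d) Nil x.

Definition tree_of_nat (n : nat) : tree := iter n (Cons Nil) Nil.

Definition computable (f : nat -> nat) : Prop :=
  exists p, forall n, exists t, runs p (tree_of_nat n) t (tree_of_nat (f n)).

(** * Parameterized problems and reductions *)

(* Instances are pairs of a bit string and a parameter.  [is_instance] singles
   out the pairs that are instances of the problem at all ("the input is a
   graph such that ..."); [is_yes] is relevant only for those.  An ordinary
   language of pairs is the case where [is_instance] always holds. *)
Record param_problem := ParamProblem {
  is_instance : seq bool -> nat -> Prop;
  is_yes : seq bool -> nat -> Prop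
}.

Definition tree_of_instance (x : seq bool) (k : nat) : tree :=
  Cons (tree_of_bits x) (tree_of_nat k).

(* Running time f(k) * (|x| + 1)^c; the "+ 1" is there because x can be empty.
   Instances must be mapped to instances. *)
Definition fpt_reduces (A B : param_problem) : Prop :=
  exists (p : cmd) (f g : nat -> nat) (c : nat),
    [/\ computable f, computable g &
        forall x k, is_instance A x k ->
          exists x' k' t,
            [/\ runs p (tree_of_instance x k) t (tree_of_instance x' k'),
                t <= f k * (size x).+1 ^ c,
                k' <= g k,
                is_instance B x' k' &
                is_yes A x k <-> is_yes B x' k']].

(** * Boolean circuits *)

(* The nodes of a circuit are listed in a topological order; the arguments of a
   gate are the positions of its in-neighbours.  The last node is the output. *)
Inductive gate :=
  | Input
  | Not of nat
  | And of seq nat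
  | Or of seq nat.

Definition circuit := seq gate.

(* [j] is the position of the gate. *)
Definition gate_wf (j : nat) (g : gate) : bool :=
  match g with
  | Input => true
  | Not i => i < j
  | And s | Or s => [&& 1 < size s, uniq s & all (fun i => i < j) s]
  end.

Definition circuit_wf (c : circuit) : bool :=
  (0 < size c) && all (fun j => gate_wf j (nth Input c j)) (iota 0 (size c)).

(* Computes a value for every node, in order, from the values [vs] of the
   preceding nodes. *)
Definition circuit_fold (T : Type) (step : seq T -> gate -> T) (c : circuit) :
  seq T := foldl (fun vs g => rcons vs (step vs g)) [::] c.

Definition is_input (g : gate) : bool := if g is Input then true else false.

(* [X] is the set of (positions of) inputs set to true. *)
Definition gate_val (X : pred nat) (vs : seq bool) (g : gate) : bool :=
  match g with
  | Input => X (size vs)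
  | Not i => ~~ nth false vs i
  | And s => all (nth false vs) s
  | Or s => has (nth false vs) s
  end.

Definition circuit_val (c : circuit) (X : pred nat) : bool :=
  last false (circuit_fold (gate_val X) c).

Definition gate_depth (ds : seq nat) (g : gate) : nat :=
  match g with
  | Input => 0
  | Not i => (nth 0 ds i).+1
  | And s | Or s => (\max_(i <- s) nth 0 ds i).+1
  end.

(* The number of edges on a longest path from an input to the output. *)
Definition circuit_depth (c : circuit) : nat :=
  last 0 (circuit_fold gate_depth c).

(* A node is large if its indegree exceeds 2. *)
Definition gate_weft (ws : seq nat) (g : gate) : nat :=
  match g with
  | Input => 0
  | Not i => nth 0 ws i
  | And s | Or s => (2 < size s) + \max_(i <- s) nth 0 ws i
  end.

(* The maximum number of large nodes on a path from an input to the output. *)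
Definition circuit_weft (c : circuit) : nat :=
  last 0 (circuit_fold gate_weft c).

Definition weight_satisfiable (c : circuit) (k : nat) : Prop :=
  exists X : {set 'I_(size c)},
    [/\ forall i, i \in X -> is_input (nth Input c i),
        #|X| = k &
        circuit_val c (fun j => j \in [seq val i | i in X])].

Definition code_nat (n : nat) : seq bool := rcons (nseq n true) false.

Definition code_seq (T : Type) (code : T -> seq bool) (s : seq T) : seq bool :=
  rcons (flatten [seq true :: code x | x <- s]) false.

Definition code_gate (g : gate) : seq bool :=
  match g with
  | Input => [:: false; false]
  | Not i => [:: false, true & code_nat i]
  | And s => [:: true, false & code_seq code_nat s]
  | Or s => [:: true, true & code_seq code_nat s]
  end.

Definition code_circuit (c : circuit) : seq bool := code_seq code_gate c.

(** * The W-hierarchy *)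

(* Weighted circuit satisfiability for circuits of weft at most [t] and depth
   at most [d], parameterized by the weight. *)
Definition weighted_circuit_sat (t d : nat) : param_problem := {|
  is_instance := fun x _ =>
    exists2 c, x = code_circuit c &
      [/\ circuit_wf c, circuit_weft c <= t & circuit_depth c <= d];
  is_yes := fun x k =>
    exists2 c, x = code_circuit c & weight_satisfiable c k
|}.

Definition in_W (t : nat) (A : param_problem) : Prop :=
  exists d, fpt_reduces A (weighted_circuit_sat t d).

Definition W_hard (t : nat) (B : param_problem) : Prop :=
  forall A, in_W t A -> fpt_reduces A B.

(** * Graphs *)

Record sgraph (V : finType) := SGraph {
  adj : rel V;
  adj_sym : symmetric adj;
  adj_irr : irreflexive adj
}.

Definition isomorphic (V W : finType) (G : sgraph V) (H : sgraph W) : Prop :=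
  exists2 h : V -> W, bijective h & forall x y, adj H (h x) (h y) = adj G x y.

(* Subdividing every edge twice.  The new vertices are the ordered pairs (x, y)
   of adjacent vertices: the edge xy is replaced by the path
   x - (x, y) - (y, x) - y. *)
Section Subdivision.

Variables (V : finType) (H : sgraph V).

Definition subdiv_vertex : finType := (V + {a : V * V | adj H a.1 a.2})%type.

Definition subdiv_adj (u v : subdiv_vertex) : bool :=
  match u, v with
  | inl _, inl _ => false
  | inl x, inr a => (val a).1 == x
  | inr a, inl x => (val a).1 == x
  | inr a, inr b => ((val a).1 == (val b).2) && ((val a).2 == (val b).1)
  end.

Lemma subdiv_adj_sym : symmetric subdiv_adj.
Proof.
move=> [x|a] [y|b] //=.
by rewrite andbC [_ == (val b).1]eq_sym [_ == (val b).2]eq_sym.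
Qed.

Lemma subdiv_adj_irr : irreflexive subdiv_adj.
Proof.
move=> [x|[[x y] /= xy]] //=; apply/negbTE/andP => -[/eqP exy _].
by rewrite exy adj_irr in xy.
Qed.

Definition subdiv2 : sgraph subdiv_vertex := SGraph subdiv_adj_sym subdiv_adj_irr.

End Subdivision.

Definition two_subdivided (V : finType) (G : sgraph V) : Prop :=
  exists (W : finType) (H : sgraph W), isomorphic G (subdiv2 H).

Definition vertex_cover (V : finType) (G : sgraph V) (S : {set V}) : Prop :=
  forall x y, adj G x y -> (x \in S) || (y \in S).

Definition dist (V : finType) (S1 S2 : {set V}) : nat :=
  #|S1 :|: S2| - #|S1 :&: S2|.

(** * LS-Vertex Cover *)

(* The number of vertices in unary, the adjacency matrix, and the
   characteristic vector of the vertex cover. *)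
Definition code_graph_set (n : nat) (G : sgraph 'I_n) (S : {set 'I_n}) :
  seq bool :=
  code_nat n ++ [seq adj G i j | i <- enum 'I_n, j <- enum 'I_n]
             ++ [seq i \in S | i <- enum 'I_n].

(* Restricted to the instances whose graph lies in the class [C]. *)
Definition LS_vertex_cover (C : forall V : finType, sgraph V -> Prop) :
  param_problem := {|
  is_instance := fun x _ =>
    exists (n : nat) (G : sgraph 'I_n) (S : {set 'I_n}),
      [/\ x = code_graph_set G S, C _ G & vertex_cover G S];
  is_yes := fun x k =>
    exists (n : nat) (G : sgraph 'I_n) (S : {set 'I_n}),
      x = code_graph_set G S /\
      exists S' : {set 'I_n},
        [/\ vertex_cover G S', dist S S' <= k & #|S'| < #|S|]
|}.

(* Main.v *)
(* A circuit of weft 1 and bounded depth is true under a set X of k inputs iff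
   boundedly many literals, each on an input or on a large gate, hold under X
   and force the output in Kleene's three-valued logic: unfold the reasons for
   the output being true and stop at the large gates whose value is due to all
   of their arguments.  Listing X in increasing order, an input is certified to
   lie outside X by two consecutive elements of X around it, so a false literal
   is refuted by boundedly many elements of X.  Hence k-weighted satisfiability
   becomes a hyperclique problem: find K nodes (elements of X with their rank,
   and the claimed literals) all of whose injective r-tuples pass a local test,
   for a constant r.

   The tuples form the left side of a bipartite graph, with the nodes and
   K^_r - K - 1 further vertices adjacent to every tuple on the right, where
   K^_r is the number of injective r-tuples of a K-set.  At most K^_r tuples
   have fewer neighbours than members iff they are all the tuples of a
   hyperclique.  After subdividing every edge twice, start from the vertex cover
   made of the left side and the new vertices next to the right side: an
   improving swap replaces a set T of left vertices by its smaller neighbourhood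
   and moves along all edges at T, so that the size of T is controlled by the
   number of exchanged vertices. *)

Require Import Defs.
From mathcomp Require Import all_boot.
From Stdlib Require Import FunctionalExtensionality.
From mathcomp Require Import zify.
Import Defs.

Set Implicit Arguments.
Unset Strict Implicit.
Unset Printing Implicit Defensive.

(** * WHILE programs *)

(** Refutations are short because of weft 1: an argument of a large gate has weft 0, so its value is
    forced by at most [2 ^ d] inputs. Each of the forcing inputs takes at most two positions of the
    list, and the node with the claims takes one more, whence [r = 2 * 2 ^ d + 1]. Sentinels at both
    ends give every false input two neighbours; [r + 1] of them on the right also make [K] exceed
    [r]. The count [K ^_ r - K - 1] works because [s ^_ r - s] grows strictly for [s >= r]: tuples
    over fewer than [K] nodes never outnumber their neighbours. Running times need care. One
    assignment can double a tree, so a time bound does not bound the size of values, and polynomial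
    functions carry a size bound of their own. Hardness quantifies over arbitrary reductions, whose
    output is fed to this one; the length of that output is controlled through the depth of its
    tree. *)

Definition st (d : tree) : store := update (fun _ => Nil) 0 d.

(** A stack frame: variable 0 becomes a protected cell and the variables of a program move up by
    one, so that shifted code runs without touching it. *)
Definition push (d : tree) (s : store) : store :=
  fun v => if v is w.+1 then s w else d.

Fixpoint shift_expr (e : expr) : expr :=
  match e with
  | EVar v => EVar v.+1
  | ENil => ENil
  | ECons e1 e2 => ECons (shift_expr e1) (shift_expr e2)
  | EHd e1 => EHd (shift_expr e1)
  | ETl e1 => ETl (shift_expr e1)
  end.

Fixpoint shift (c : cmd) : cmd :=
  match c with
  | Assign v e => Assign v.+1 (shift_expr e)
  | Seq c1 c2 => Seq (shift c1) (shift c2)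
  | If e c1 c2 => If (shift_expr e) (shift c1) (shift c2)
  | While e c1 => While (shift_expr e) (shift c1)
  end.

Lemma eval_shift d s e : eval (push d s) (shift_expr e) = eval s e.
Proof. by elim: e => //= [e1 -> e2 ->|e ->|e ->]. Qed.

Lemma update_push d s v d' :
  update (push d s) v.+1 d' = push d (update s v d').
Proof. by apply: functional_extensionality => -[|w]. Qed.

Lemma exec_shift c s t s' d :
  exec c s t s' -> exec (shift c) (push d s) t (push d s').
Proof.
elim=> {c s t s'} /= [v e s|c1 c2 s s1 s2 t1 t2 _ h1 _ h2|e c1 c2 s s1 t he _ h
  |e c1 c2 s s1 t he _ h|e c s s1 s2 t1 t2 he _ h1 _ h2|e c s he].
- by rewrite -update_push -(eval_shift d); apply: ExecAssign.
- exact: ExecSeq h1 h2.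
- by apply: ExecIfTrue; rewrite ?eval_shift.
- by apply: ExecIfFalse; rewrite ?eval_shift.
- by apply: ExecWhileTrue h1 h2; rewrite eval_shift.
- by apply: ExecWhileFalse; rewrite eval_shift.
Qed.

Lemma exec_assign v e s s' :
  (forall w, update s v (eval s e) w = s' w) -> exec (Assign v e) s 1 s'.
Proof.
move=> h; rewrite -(_ : update s v (eval s e) = s'); first exact: ExecAssign.
exact: functional_extensionality.
Qed.

(** Both programs need the input and there is one store: [p] runs shifted with the input kept in
    variable 0, then [q] runs shifted with the result of [p] kept there. The moves in between
    prepare exactly the clean store that the next run expects; the seven assignments are the 7 of
    [exec_pair]. *)
Definition pair_cmd (p q : cmd) : cmd :=
  Seq (Assign 1 (EVar 0)) (Seq (shift p)
  (Seq (Assign 2 (EVar 1)) (Seq (Assign 1 (EVar 0)) (Seq (Assign 0 (EVar 2))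
  (Seq (Assign 2 ENil) (Seq (shift q)
  (Seq (Assign 0 (ECons (EVar 0) (EVar 1))) (Assign 1 ENil)))))))).

Lemma exec_pair p q x y z t1 t2 :
  exec p (st x) t1 (st y) -> exec q (st x) t2 (st z) ->
  exec (pair_cmd p q) (st x) (t1 + t2 + 7) (st (Cons y z)).
Proof.
move=> /(exec_shift x) hp /(exec_shift y) hq.
have -> : t1 + t2 + 7 = 1 + (t1 + (1 + (1 + (1 + (1 + (t2 + (1 + 1))))))) by lia.
apply: (ExecSeq (s1 := push x (st x))); first by apply: exec_assign => -[|[|w]].
apply: ExecSeq hp _.
apply: (ExecSeq (s1 := push x (push y (st y)))).
  by apply: exec_assign => -[|[|[|w]]].
apply: (ExecSeq (s1 := push x (push x (st y)))).
  by apply: exec_assign => -[|[|[|w]]].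
apply: (ExecSeq (s1 := push y (push x (st y)))).
  by apply: exec_assign => -[|[|[|w]]].
apply: (ExecSeq (s1 := push y (st x))); first by apply: exec_assign => -[|[|[|w]]].
apply: ExecSeq hq _.
apply: (ExecSeq (s1 := push (Cons y z) (st z))).
  by apply: exec_assign => -[|[|w]].
by apply: exec_assign => -[|[|w]].
Qed.

Lemma exec_expr e x : exec (Assign 0 e) (st x) 1 (st (eval (st x) e)).
Proof. by apply: exec_assign => -[|w]. Qed.

Fixpoint expr_bound (e : expr) : nat :=
  match e with
  | EVar v => v.+1
  | ENil => 0
  | ECons e1 e2 => maxn (expr_bound e1) (expr_bound e2)
  | EHd e1 | ETl e1 => expr_bound e1
  end.

Fixpoint assigned (c : cmd) : nat :=
  match c with
  | Assign v e => v.+1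
  | Seq c1 c2 | If _ c1 c2 => maxn (assigned c1) (assigned c2)
  | While _ c1 => assigned c1
  end.

Lemma exec_unassigned c s t s' v :
  exec c s t s' -> assigned c <= v -> s' v = s v.
Proof.
elim=> {c s t s'} /= [w e s|c1 c2 s s1 s2 t1 t2 _ h1 _ h2|e c1 c2 s s1 t he _ h
  |e c1 c2 s s1 t he _ h|e c s s1 s2 t1 t2 he _ h1 _ h2|e c s he].
- by move=> lwv; rewrite /update ifN //; lia.
- by rewrite geq_max => /andP[/h1 e1 /h2 e2]; rewrite e2.
- by rewrite geq_max => /andP[/h].
- by rewrite geq_max => /andP[_ /h].
- by move=> lv; rewrite h2 // h1.
- by [].
Qed.

Fixpoint clear (m : nat) : cmd :=
  if m is m'.+1 then Seq (Assign m ENil) (clear m') else Assign 0 (EVar 0).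

Lemma exec_clear m s : (forall v, m < v -> s v = Nil) ->
  exec (clear m) s m.+1 (st (s 0)).
Proof.
elim: m s => [|m IHm] s hs /=.
  by apply: exec_assign => -[|w]; rewrite /update //= hs.
rewrite -(addn1 m.+1) addnC; apply: (ExecSeq (s1 := update s m.+1 Nil)).
  by apply: exec_assign => w.
have := IHm (update s m.+1 Nil); apply => v ltmv; rewrite /update.
by case: eqP => // nv; apply: hs; lia.
Qed.

(** [runs] constrains only variable 0 at the end, while sequential composition needs all others to
    be [Nil]. Variables beyond those assigned by [p] are still [Nil], so finitely many resets clean
    the store. *)
Lemma runs_clean p : exists q, forall x t y, runs p x t y ->
  exec q (st x) (t + (assigned p).+1) (st y).
Proof.
exists (Seq p (clear (assigned p))) => x t y [s es <-].
apply: ExecSeq (es) _; apply: exec_clear => v ltv.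
by rewrite (exec_unassigned es) ?(ltnW ltv) //; case: v ltv.
Qed.

(** * Growth of values along an execution *)

Fixpoint depth (d : tree) : nat :=
  if d is Cons a b then (maxn (depth a) (depth b)).+1 else 0.

Fixpoint expr_depth (e : expr) : nat :=
  match e with
  | EVar _ | ENil => 0
  | ECons e1 e2 => (maxn (expr_depth e1) (expr_depth e2)).+1
  | EHd e1 | ETl e1 => expr_depth e1
  end.

Fixpoint cmd_depth (c : cmd) : nat :=
  match c with
  | Assign v e => expr_depth e
  | Seq c1 c2 | If _ c1 c2 => maxn (cmd_depth c1) (cmd_depth c2)
  | While _ c1 => cmd_depth c1
  end.

Lemma depth_eval s e D : (forall v, depth (s v) <= D) ->
  depth (eval s e) <= D + expr_depth e.
Proof.
move=> hs; elim: e => //= [v|e1 h1 e2 h2|e h|e h].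
- by rewrite addn0.
- lia.
- by case: (eval s e) h => //= a b; lia.
- by case: (eval s e) h => //= a b; lia.
Qed.

(** Depth, unlike size, is additive in time: an expression adds at most its own nesting, however
    often it repeats a variable. *)
Lemma depth_exec c s t s' : exec c s t s' -> forall D C, cmd_depth c <= C ->
  (forall v, depth (s v) <= D) -> forall v, depth (s' v) <= D + C * t.
Proof.
elim=> {c s t s'} /= [w e s|c1 c2 s s1 s2 t1 t2 _ h1 _ h2|e c1 c2 s s1 t he _ h
  |e c1 c2 s s1 t he _ h|e c s s1 s2 t1 t2 he _ h1 _ h2|e c s he] D C hC hD v.
- rewrite muln1 /update; case: eqP => _; last exact: leq_trans (hD v) (leq_addr _ _).
  by apply: leq_trans (depth_eval e hD) _; lia.
- by rewrite mulnDr addnA; apply: h2; [lia|]; apply: h1; [lia|].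
- by have := h D C ltac:(lia) hD v; lia.
- by have := h D C ltac:(lia) hD v; lia.
- have := h2 (D + C * t1) C ltac:(lia) _ v; rewrite mulnS mulnDr.
  by move=> /(_ (h1 _ _ hC hD)); lia.
- by apply: leq_trans (hD v) _; lia.
Qed.

(** * Polynomial-time functions *)

Class Enc (A : Type) := enc : A -> tree.

#[global] Instance enc_unit : Enc unit := fun _ => Nil.
#[global] Instance enc_bool : Enc bool := tree_of_bool.
#[global] Instance enc_nat : Enc nat := tree_of_nat.
#[global] Instance enc_prod A B (eA : Enc A) (eB : Enc B) : Enc (A * B) :=
  fun p => Cons (enc p.1) (enc p.2).
#[global] Instance enc_list A (eA : Enc A) : Enc (seq A) :=
  foldr (fun a d => Cons (enc a) d) Nil.

Fixpoint tsize (d : tree) : nat :=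
  if d is Cons a b then (tsize a + tsize b).+1 else 0.

Definition esz A {eA : Enc A} (a : A) : nat := tsize (enc a).

Lemma esz_nat (n : nat) : esz n = n.
Proof. by elim: n => //= n IHn; rewrite /esz /= -[tsize _]/(esz n) IHn. Qed.

Lemma esz_bool (b : bool) : esz b = b.
Proof. by case: b. Qed.

Lemma esz_pair A B {eA : Enc A} {eB : Enc B} (p : A * B) :
  esz p = (esz p.1 + esz p.2).+1.
Proof. by []. Qed.

Lemma esz_nil A {eA : Enc A} : esz ([::] : seq A) = 0.
Proof. by []. Qed.

Lemma esz_cons A {eA : Enc A} (a : A) (s : seq A) :
  esz (a :: s) = (esz a + esz s).+1.
Proof. by []. Qed.

Definition eszE := (esz_nat, esz_bool, @esz_pair, @esz_nil, @esz_cons).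

Lemma esz_cat A {eA : Enc A} (s1 s2 : seq A) :
  esz (s1 ++ s2) = esz s1 + esz s2.
Proof. by elim: s1 => //= a s1 IH; rewrite !esz_cons IH addnA addSn. Qed.

Lemma esz_rcons A {eA : Enc A} (s : seq A) a : esz (rcons s a) = (esz a + esz s).+1.
Proof. by rewrite -cats1 esz_cat esz_cons esz_nil; lia. Qed.

Lemma esz_rev A {eA : Enc A} (s : seq A) : esz (rev s) = esz s.
Proof. by elim: s => //= a s IH; rewrite rev_cons esz_rcons IH esz_cons. Qed.

Lemma size_esz A {eA : Enc A} (s : seq A) : size s <= esz s.
Proof. by elim: s => //= a s IH; rewrite esz_cons; lia. Qed.

Lemma esz_le_size A {eA : Enc A} (s : seq A) m :
  all (fun a => esz a <= m) s -> esz s <= size s * m.+1.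
Proof.
elim: s => [|a s IH] /=; first by rewrite esz_nil.
by move=> /andP[ha /IH]; rewrite esz_cons; nia.
Qed.

(** The summand 2 keeps the base at least 2 even for empty data, so that constants and sums of
    powers stay below a single power. *)
Definition polyb A {eA : Enc A} (T : A -> nat) : Prop :=
  exists c, forall a, T a <= (esz a + 2) ^ c.

Section PolyBounds.

Variables (A : Type) (eA : Enc A).
Implicit Types T : A -> nat.

Lemma polyb_le T1 T2 : (forall a, T1 a <= T2 a) -> polyb T2 -> polyb T1.
Proof. by move=> h [c hc]; exists c => a; apply: leq_trans (h a) (hc a). Qed.

Lemma leq_base_exp m n c : m <= n -> m ^ c <= n ^ c.
Proof. by case: c => [|c] // h; rewrite leq_exp2r. Qed.

Lemma polyb_cst n : polyb (fun _ : A => n).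
Proof.
exists n => a; apply: leq_trans (ltnW (ltn_expl n (ltnSn 1))) _.
by apply: leq_base_exp; lia.
Qed.

Lemma polyb_esz : polyb (fun a : A => esz a).
Proof. by exists 1 => a; rewrite expn1; lia. Qed.

Lemma polyb_mul T1 T2 : polyb T1 -> polyb T2 -> polyb (fun a => T1 a * T2 a).
Proof.
by move=> [c1 h1] [c2 h2]; exists (c1 + c2) => a; rewrite expnD leq_mul.
Qed.

Lemma polyb_add T1 T2 : polyb T1 -> polyb T2 -> polyb (fun a => T1 a + T2 a).
Proof.
move=> [c1 h1] [c2 h2]; exists (c1 + c2).+1 => a.
have := h1 a; have := h2 a; rewrite expnS expnD.
have : 0 < (esz a + 2) ^ c1 by rewrite expn_gt0 addn2.
have : 0 < (esz a + 2) ^ c2 by rewrite expn_gt0 addn2.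
by nia.
Qed.

Lemma polyb_exp T n : polyb T -> polyb (fun a => T a ^ n).
Proof.
by move=> [c h]; exists (c * n) => a; rewrite expnM; apply: leq_base_exp.
Qed.

Lemma polyb_succ T : polyb T -> polyb (fun a => (T a).+1).
Proof.
move=> hT; apply: (@polyb_le _ (fun a => T a + 1)) => [a|]; first lia.
by apply: polyb_add => //; apply: polyb_cst.
Qed.

Lemma polyb_comp B {eB : Enc B} (f : A -> B) (T : B -> nat) :
  polyb (fun a => esz (f a)) -> polyb T -> polyb (fun a => T (f a)).
Proof.
move=> hf [c hc]; apply: polyb_le (fun a => hc (f a)) _.
by apply: polyb_exp; apply: polyb_add => //; apply: polyb_cst.
Qed.

End PolyBounds.

(** In a loop the argument of the body changes from round to round and only its size is under
    control; a monotone function of the size bounds all rounds at once. *)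
Lemma polyb_mono A B {eA : Enc A} {eB : Enc B} (T : B -> nat) : polyb T ->
  exists2 U : nat -> nat, (forall b, T b <= U (esz b)) &
    (forall m n, m <= n -> U m <= U n) /\
    (forall f : A -> nat, polyb f -> polyb (fun a => U (f a))).
Proof.
move=> [c hc]; exists (fun n => (n + 2) ^ c) => //; split=> [m n h|f hf].
  by apply: leq_base_exp; lia.
by apply: polyb_exp; apply: polyb_add => //; apply: polyb_cst.
Qed.

Ltac polyb := repeat first
  [ assumption | apply: polyb_cst | apply: polyb_esz | apply: polyb_add
  | apply: polyb_mul | apply: polyb_succ | apply: polyb_exp ].

(** Start and end stores are clean, so programs compose by [Seq]. The last clause does not follow
    from the time bound: duplicating a variable repeatedly yields exponential size in linear
    time. *)
Definition FP A B {eA : Enc A} {eB : Enc B} (f : A -> B) : Prop :=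
  exists p T, [/\ forall a, exists2 t, t <= T a &
                    exec p (st (enc a)) t (st (enc (f a))),
                  polyb T & polyb (fun a => esz (f a))].

Section Combinators.

Variables (A B : Type).
Context {eA : Enc A} {eB : Enc B}.

Lemma FP_ext (f g : A -> B) : f =1 g -> FP g -> FP f.
Proof. by move=> fg; rewrite (functional_extensionality _ _ fg). Qed.

Lemma FP_size (f : A -> B) : FP f -> polyb (fun a => esz (f a)).
Proof. by case=> p [T []]. Qed.

Lemma FP_expr e (f : A -> B) : (forall a, eval (st (enc a)) e = enc (f a)) ->
  polyb (fun a => esz (f a)) -> FP f.
Proof.
move=> he hf; exists (Assign 0 e), (fun=> 1); split=> //; last exact: polyb_cst.
by move=> a; exists 1 => //; rewrite -he; apply: exec_expr.
Qed.

End Combinators.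

Section Combinators2.

Variables (A B C : Type).
Context {eA : Enc A} {eB : Enc B} {eC : Enc C}.

Lemma FP_id : FP (fun a : A => a).
Proof. by apply: (FP_expr (e := EVar 0)) => //; polyb. Qed.

Lemma FP_comp (f : A -> B) (g : B -> C) : FP g -> FP f -> FP (fun a => g (f a)).
Proof.
move=> [q [U [hq bU bg]]] [p [T [hp bT bf]]].
exists (Seq p q), (fun a => T a + U (f a)); split.
- move=> a; have [t ht et] := hp a; have [u hu eu] := hq (f a).
  by exists (t + u); [lia | apply: ExecSeq et eu].
- by apply: polyb_add => //; apply: (polyb_comp bf bU).
- exact: (polyb_comp bf bg).
Qed.

Lemma FP_pair (f : A -> B) (g : A -> C) :
  FP f -> FP g -> FP (fun a => (f a, g a)).
Proof.
move=> [p [T [hp bT bf]]] [q [U [hq bU bg]]].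
exists (pair_cmd p q), (fun a => T a + U a + 7); split; last 1 first.
- by apply: (polyb_succ (T := fun a => esz (f a) + esz (g a))); polyb.
- move=> a; have [t ht et] := hp a; have [u hu eu] := hq a.
  by exists (t + u + 7); [lia | apply: exec_pair].
- by polyb.
Qed.

End Combinators2.

Section Basic.

Variables (E A B : Type).
Context {eE : Enc E} {eA : Enc A} {eB : Enc B}.

Lemma FP_fst (f : E -> A * B) : FP f -> FP (fun e => (f e).1).
Proof.
apply: (FP_comp (g := fst)); apply: (FP_expr (e := EHd (EVar 0))) => //.
by apply: polyb_le (polyb_esz _) => p; rewrite esz_pair; lia.
Qed.

Lemma FP_snd (f : E -> A * B) : FP f -> FP (fun e => (f e).2).
Proof.
apply: (FP_comp (g := snd)); apply: (FP_expr (e := ETl (EVar 0))) => //.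
by apply: polyb_le (polyb_esz _) => p; rewrite esz_pair; lia.
Qed.

Fixpoint cst_expr (d : tree) : expr :=
  if d is Cons a b then ECons (cst_expr a) (cst_expr b) else ENil.

Lemma FP_cst (a : A) : FP (fun _ : E => a).
Proof.
apply: (FP_expr (e := cst_expr (enc a))) => [e|]; last exact: polyb_cst.
by elim: (enc a) => //= b -> c ->.
Qed.

Lemma FP_cons (f : E -> A) (g : E -> seq A) :
  FP f -> FP g -> FP (fun e => f e :: g e).
Proof.
move=> hf hg; have := FP_pair hf hg.
apply: (FP_comp (g := fun p : A * seq A => p.1 :: p.2)).
by apply: (FP_expr (e := EVar 0)) => //; apply: polyb_esz.
Qed.

Lemma FP_behead (f : E -> seq A) : FP f -> FP (fun e => behead (f e)).
Proof.
apply: FP_comp; apply: (FP_expr (e := ETl (EVar 0))) => [[]//|].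
by apply: polyb_le (polyb_esz _) => -[|a s] //; rewrite esz_cons /=; lia.
Qed.

Lemma FP_succ (f : E -> nat) : FP f -> FP (fun e => (f e).+1).
Proof.
apply: (FP_comp (g := S)); apply: (FP_expr (e := ECons ENil (EVar 0))) => //.
by apply: (polyb_succ (T := fun n => esz n)); polyb.
Qed.

Lemma FP_pred (f : E -> nat) : FP f -> FP (fun e => (f e).-1).
Proof.
apply: FP_comp; apply: (FP_expr (e := ETl (EVar 0))) => [[]//|].
by apply: polyb_le (polyb_esz _) => n; rewrite !esz_nat; lia.
Qed.

Lemma FP_lt0n (f : E -> nat) : FP f -> FP (fun e => 0 < f e).
Proof.
apply: (FP_comp (g := fun n => 0 < n)).
pose e := ECons (EHd (EVar 0)) (EHd (EVar 0)).
pose p := If (EVar 0) (Assign 0 (ECons ENil ENil)) (Assign 0 ENil).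
exists p, (fun=> 2); split; [|exact: polyb_cst|]; last first.
  by apply: polyb_le (polyb_cst _ 1) => n; rewrite esz_bool; case: (0 < n).
move=> n; exists 2 => //; case: n => [|n].
  by apply: ExecIfFalse => //; apply: (@exec_expr ENil).
by apply: ExecIfTrue => //; apply: (@exec_expr (ECons ENil ENil)).
Qed.

(** The test is computed next to a copy of the input, because the branches need the input again. *)
Lemma FP_if (b : E -> bool) (f g : E -> A) :
  FP b -> FP f -> FP g -> FP (fun e => if b e then f e else g e).
Proof.
move=> hb [p [T [hp bT bf]]] [q [U [hq bU bg]]].
have [r [V [hr bV _]]] := FP_pair hb (FP_id (A := E)).
exists (Seq r (If (EHd (EVar 0)) (Seq (Assign 0 (ETl (EVar 0))) p)
                                 (Seq (Assign 0 (ETl (EVar 0))) q))).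
exists (fun a => V a + (T a + U a + 2)); split; last 1 first.
- apply: (@polyb_le _ _ _ (fun a => esz (f a) + esz (g a))); last by polyb.
  by move=> a; case: (b a); lia.
- move=> a; have [v hv ev] := hr a.
  have hb1 : truthy (enc (b a)) = b a by case: (b a).
  case: ifP => ba.
    have [t ht et] := hp a; exists (v + (1 + t).+1); first lia.
    apply: ExecSeq ev _; apply: ExecIfTrue; first by rewrite /= hb1.
    by apply: ExecSeq (et); apply: (exec_expr (ETl (EVar 0))).
  have [t ht et] := hq a; exists (v + (1 + t).+1); first lia.
  apply: ExecSeq ev _; apply: ExecIfFalse; first by rewrite /= hb1 ba.
  by apply: ExecSeq (et); apply: (exec_expr (ETl (EVar 0))).
- by polyb.
Qed.

End Basic.

Lemma FP_proj1 A B {eA : Enc A} {eB : Enc B} : FP (@fst A B).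
Proof. by have h := FP_fst (FP_id (A := (A * B)%type)). Qed.

Lemma FP_proj2 A B {eA : Enc A} {eB : Enc B} : FP (@snd A B).
Proof. by have h := FP_snd (FP_id (A := (A * B)%type)). Qed.

Lemma FP_comp2 E A B C {eE : Enc E} {eA : Enc A} {eB : Enc B} {eC : Enc C}
    (h : A -> B -> C) (f : E -> A) (g : E -> B) :
  FP (fun x : A * B => h x.1 x.2) -> FP f -> FP g ->
  FP (fun e => h (f e) (g e)).
Proof. by move=> hh hf hg; apply: FP_comp hh (FP_pair hf hg). Qed.

Section Fold.

Variables (E A B : Type).
Context {eE : Enc E} {eA : Enc A} {eB : Enc B}.

(** A polynomial body alone does not suffice, since iterating it could make the accumulator explode;
    [bd] bounds every intermediate accumulator. *)
Lemma FP_foldl_gen (h : E -> B -> A -> B) (z : E -> B) (l : E -> seq A)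
    (bd : E -> nat) :
  FP (fun x : E * (B * A) => h x.1 x.2.1 x.2.2) -> FP z -> FP l -> polyb bd ->
  (forall e l1 l2, l e = l1 ++ l2 -> esz (foldl (h e) (z e) l1) <= bd e) ->
  FP (fun e => foldl (h e) (z e) (l e)).
Proof.
move=> hh hz hl bb hbd.
(* A nonempty list and the pair of its head and tail are the same tree. Hence the body can be a
   function on [I], without a case analysis on the list, and the head of the loop state doubles as
   the loop test. *)
pose I : Type := ((A * seq A) * (E * B))%type.
have h1 : FP (fun x : I => x.1.1) by do 2!apply: FP_fst; apply: FP_id.
have h2 : FP (fun x : I => x.1.2) by apply: FP_snd; apply: FP_fst; apply: FP_id.
have h3 : FP (fun x : I => x.2.1) by apply: FP_fst; apply: FP_snd; apply: FP_id.
have h4 : FP (fun x : I => x.2.2) by do 2!apply: FP_snd; apply: FP_id.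
have h5 : FP (fun x : I => (x.1.2, (x.2.1, h x.2.1 x.2.2 x.1.1))).
  apply: FP_pair => //; apply: FP_pair => //.
  exact: FP_comp hh (FP_pair h3 (FP_pair h4 h1)).
have h6 := FP_pair hl (FP_pair (FP_id (A := E)) hz).
have [q [U [hq bU _]]] := h5; have [p [T [hp bT _]]] := h6.
have [V hV [monoV bV]] := polyb_mono (A := E) bU.
pose (W := fun e => esz (l e) * (V (esz (l e) + esz e + bd e + 2)).+1).
exists (Seq p (Seq (While (EHd (EVar 0)) q) (Assign 0 (ETl (ETl (EVar 0)))))).
exists (fun e => T e + (W e + 2)); split.
- move=> e; have [t ht et] := hp e.
  assert (main : forall l1 l2, l e = l1 ++ l2 ->
      exists2 u, u <= size l2 * (V (esz (l e) + esz e + bd e + 2)).+1 + 1 &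
      exec (While (EHd (EVar 0)) q)
      (st (enc (l2, (e, foldl (h e) (z e) l1)))) u
      (st (enc (([::] : seq A), (e, foldl (h e) (z e) (l e)))))).
  { move=> l1 l2; elim: l2 l1 => [|a l2 IH] l1 hl12.
      by exists 1 => //; rewrite hl12 cats0; apply: ExecWhileFalse.
    have [u hu eu] := IH (rcons l1 a) ltac:(by rewrite cat_rcons).
    have [v hv ev] := hq ((a, l2), (e, foldl (h e) (z e) l1)).
    rewrite foldl_rcons in eu; exists (v + u).+1; last exact: ExecWhileTrue ev eu.
    have : U (a, l2, (e, foldl (h e) (z e) l1)) <=
        V (esz (l e) + esz e + bd e + 2).
      apply: leq_trans (hV _) (monoV _ _ _).
      have := hbd e _ _ hl12; rewrite hl12 esz_cat !eszE /=; lia.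
    by rewrite /= mulSn; lia. }
  have [u hu eu] := main [::] (l e) erefl.
  exists (t + (u + 1)).
    have : size (l e) <= esz (l e) by apply: size_esz.
    by move: hu; rewrite /W; nia.
  apply: ExecSeq et (ExecSeq eu _).
  by apply: (exec_expr (ETl (ETl (EVar 0)))).
- apply: polyb_add => //; apply: polyb_add; last exact: polyb_cst.
  apply: polyb_mul; first exact: FP_size.
  by apply: polyb_succ; apply: bV; polyb; apply: FP_size.
- by apply: polyb_le bb => e; apply: (hbd e _ [::]); rewrite cats0.
Qed.

End Fold.

Section Lists.

Variables (E A B : Type).
Context {eE : Enc E} {eA : Enc A} {eB : Enc B}.

Lemma foldl_cons_rev (T : Type) (s acc : seq T) :
  foldl (fun s a => a :: s) acc s = rev s ++ acc.
Proof. by elim: s acc => //= a s IH acc; rewrite IH rev_cons cat_rcons. Qed.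

Lemma FP_rev (l : E -> seq A) : FP l -> FP (fun e => rev (l e)).
Proof.
apply: FP_comp.
apply: (FP_ext (g := fun s => foldl (fun s a => a :: s) [::] s)).
  by move=> s; rewrite foldl_cons_rev cats0.
apply: (FP_foldl_gen (bd := fun s => esz s)).
- by apply: FP_cons; [do 2 apply: FP_snd | apply: FP_fst; apply: FP_snd];
    apply: FP_id.
- exact: FP_cst.
- exact: FP_id.
- exact: polyb_esz.
- by move=> s s1 s2 ->; rewrite foldl_cons_rev cats0 esz_rev esz_cat; lia.
Qed.

End Lists.

Section Lists2.

Variables (E A B : Type).
Context {eE : Enc E} {eA : Enc A} {eB : Enc B}.

Lemma FP_foldr_gen (h : E -> A -> B -> B) (z : E -> B) (l : E -> seq A)
    (bd : E -> nat) :
  FP (fun x : E * (A * B) => h x.1 x.2.1 x.2.2) -> FP z -> FP l -> polyb bd ->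
  (forall e l1 l2, l e = l1 ++ l2 -> esz (foldr (h e) (z e) l2) <= bd e) ->
  FP (fun e => foldr (h e) (z e) (l e)).
Proof.
move=> hh hz hl bb hbd.
apply: (FP_ext (g := fun e => foldl (fun b a => h e a b) (z e) (rev (l e)))).
  by move=> e; rewrite foldl_rev.
apply: (FP_foldl_gen (h := fun e b a => h e a b) (bd := bd)) => //.
- apply: (FP_comp (g := fun x : E * (A * B) => h x.1 x.2.1 x.2.2)
          (f := fun x => (x.1, (x.2.2, x.2.1)))) => //.
  apply: FP_pair; first by apply: FP_fst; apply: FP_id.
  apply: FP_pair; first by do 2 apply: FP_snd; apply: FP_id.
  by apply: FP_fst; apply: FP_snd; apply: FP_id.
- exact: FP_rev.
- move=> e l1 l2 el; have := hbd e (rev l2) (rev l1).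
  by rewrite -rev_cat -el revK -foldl_rev revK => /(_ erefl).
Qed.

End Lists2.

Section Map.

Variables (E A B : Type).
Context {eE : Enc E} {eA : Enc A} {eB : Enc B}.

Lemma FP_map (h : E -> A -> B) (l : E -> seq A) :
  FP (fun x : E * A => h x.1 x.2) -> FP l -> FP (fun e => map (h e) (l e)).
Proof.
move=> hh hl.
have [U hU [monoU bU]] := polyb_mono (A := E) (FP_size hh).
apply: (FP_ext (g := fun e => foldr (fun a s => h e a :: s) [::] (l e))).
  by move=> e; elim: (l e) => //= a s ->.
apply: (FP_foldr_gen (h := fun e a s => h e a :: s) (z := fun=> [::])
  (bd := fun e => esz (l e) * (U (esz (l e) + esz e + 1)).+1)).
- apply: FP_cons; last by do 2 apply: FP_snd; apply: FP_id.
  apply: (FP_comp2 (h := h)) => //; first by apply: FP_fst; apply: FP_id.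
  by apply: FP_fst; apply: FP_snd; apply: FP_id.
- exact: FP_cst.
- exact: hl.
- have := FP_size hl => bl; apply: polyb_mul => //; apply: polyb_succ.
  by apply: bU; polyb.
move=> e l1 l2 el.
have : esz l2 <= esz (l e) by rewrite el esz_cat leq_addl.
have hsz : size l2 <= esz (l e).
  by rewrite el esz_cat; have := @size_esz A eA l2; lia.
move=> hle; set m := U _.
apply: leq_trans (_ : size l2 * m.+1 <= _); last by rewrite leq_mul2r hsz orbT.
elim: l2 hle {el hsz} => [|a l2 IH] /=; rewrite ?esz_nil // !esz_cons => hle.
have : esz (h e a) <= m.
  by apply: leq_trans (hU (e, a)) _; apply: monoU; rewrite esz_pair /=; lia.
by rewrite mulSn; have := IH ltac:(lia); lia.
Qed.

End Map.

Section Nat.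

Variables (E A : Type).
Context {eE : Enc E} {eA : Enc A}.

(** A unary number and a list of that many units are the same tree, which turns iteration into a
    fold. *)
Lemma FP_ticks (f : E -> nat) : FP f -> FP (fun e => nseq (f e) tt).
Proof.
have encE n : enc n = enc (nseq n tt).
  by elim: n => // n IH; rewrite -[LHS]/(Cons Nil (enc n)) IH.
apply: FP_comp; apply: (FP_expr (e := EVar 0)) => [n|]; first exact: encE.
by apply: polyb_le (polyb_esz _) => n; rewrite /esz -encE.
Qed.

Lemma FP_iter_gen (h : E -> A -> A) (z : E -> A) (f : E -> nat)
    (bd : E -> nat) :
  FP (fun x : E * A => h x.1 x.2) -> FP z -> FP f -> polyb bd ->
  (forall e n, n <= f e -> esz (iter n (h e) (z e)) <= bd e) ->
  FP (fun e => iter (f e) (h e) (z e)).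
Proof.
have foldr_nseq e n : foldr (fun _ a => h e a) (z e) (nseq n tt) = iter n (h e) (z e).
  by elim: n => //= n ->.
move=> hh hz hf bb hbd.
apply: (FP_ext (g := fun e => foldr (fun _ a => h e a) (z e) (nseq (f e) tt))).
  by move=> e; rewrite foldr_nseq.
apply: (FP_foldr_gen (h := fun e _ a => h e a) (bd := bd)) => //.
- apply: (FP_comp (g := fun x : E * A => h x.1 x.2) (f := fun x => (x.1, x.2.2))) => //.
  by apply: FP_pair; [apply: FP_fst | do 2 apply: FP_snd]; apply: FP_id.
- exact: FP_ticks.
move=> e l1 l2 el; have sz := congr1 size el; rewrite size_nseq size_cat in sz.
have -> : l2 = nseq (size l2) tt by apply/all_pred1P; apply/allP => -[].
by rewrite foldr_nseq; apply: hbd; lia.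
Qed.

End Nat.

Section Additive.

Variables (E A B : Type).
Context {eE : Enc E} {eA : Enc A} {eB : Enc B}.

(** If a round adds an amount that does not depend on the accumulator, the intermediate sizes grow
    linearly in the number of rounds, which supplies the bound asked for by [FP_foldl_gen]. *)
Lemma FP_foldl (h : E -> B -> A -> B) (z : E -> B) (l : E -> seq A)
    (G : E * A -> nat) :
  FP (fun x : E * (B * A) => h x.1 x.2.1 x.2.2) -> FP z -> FP l -> polyb G ->
  (forall e b a, esz (h e b a) <= esz b + G (e, a)) ->
  FP (fun e => foldl (h e) (z e) (l e)).
Proof.
move=> hh hz hl bG hG.
have [U hU [monoU bU]] := polyb_mono (A := E) bG.
apply: (FP_foldl_gen (bd := fun e => esz (z e) +
    esz (l e) * U (esz (l e) + esz e + 1))) => //.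
  apply: polyb_add; first exact: FP_size.
  apply: polyb_mul; first exact: FP_size.
  by apply: bU; polyb; apply: FP_size.
move=> e l1 l2 el.
have : esz l1 <= esz (l e) by rewrite el esz_cat leq_addr.
have : size l1 <= esz (l e).
  by rewrite el esz_cat; have := @size_esz A eA l1; lia.
set m := U _ => hsz hle.
apply: leq_trans (_ : esz (z e) + size l1 * m <= _).
  elim/last_ind: l1 hle {el hsz} => [|s a IH] hle; first by rewrite leq_addr.
  rewrite foldl_rcons size_rcons mulSn; apply: leq_trans (hG _ _ _) _.
  have : G (e, a) <= m.
    apply: leq_trans (hU _) _; apply: monoU.
    by move: hle; rewrite esz_rcons esz_pair /=; lia.
  by move: hle; rewrite esz_rcons => hle; have := IH ltac:(lia); lia.
by rewrite leq_add2l leq_mul2r hsz orbT.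
Qed.

Lemma FP_foldr (h : E -> A -> B -> B) (z : E -> B) (l : E -> seq A)
    (G : E * A -> nat) :
  FP (fun x : E * (A * B) => h x.1 x.2.1 x.2.2) -> FP z -> FP l -> polyb G ->
  (forall e a b, esz (h e a b) <= esz b + G (e, a)) ->
  FP (fun e => foldr (h e) (z e) (l e)).
Proof.
move=> hh hz hl bG hG.
apply: (FP_ext (g := fun e => foldl (fun b a => h e a b) (z e) (rev (l e)))).
  by move=> e; rewrite foldl_rev.
apply: (FP_foldl (h := fun e b a => h e a b)) bG _ => //; last exact: FP_rev.
apply: (FP_comp (g := fun x : E * (A * B) => h x.1 x.2.1 x.2.2)
        (f := fun x => (x.1, (x.2.2, x.2.1)))) => //.
apply: FP_pair; first by apply: FP_fst; apply: FP_id.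
apply: FP_pair; first by do 2 apply: FP_snd; apply: FP_id.
by apply: FP_fst; apply: FP_snd; apply: FP_id.
Qed.

Lemma FP_iter (h : E -> B -> B) (z : E -> B) (n : E -> nat) (G : E -> nat) :
  FP (fun x : E * B => h x.1 x.2) -> FP z -> FP n -> polyb G ->
  (forall e b, esz (h e b) <= esz b + G e) ->
  FP (fun e => iter (n e) (h e) (z e)).
Proof.
move=> hh hz hn bG hG.
apply: (FP_iter_gen (bd := fun e => esz (z e) + n e * G e)) => //.
  apply: polyb_add; first exact: FP_size.
  apply: polyb_mul => //; apply: polyb_le (FP_size hn) => e.
  by rewrite esz_nat.
move=> e m hm; apply: leq_trans (_ : esz (z e) + m * G e <= _); last first.
  by rewrite leq_add2l leq_mul2r hm orbT.
elim: m {hm} => [|m IH]; first exact: leq_addr.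
by rewrite iterS mulSn; apply: leq_trans (hG _ _) _; lia.
Qed.

End Additive.

Section Ops.

Variables (E : Type).
Context {eE : Enc E}.
Implicit Types (b : E -> bool) (n : E -> nat).

Lemma FP_andb b1 b2 : FP b1 -> FP b2 -> FP (fun e => b1 e && b2 e).
Proof. by move=> h1 h2; apply: FP_if h1 h2 (FP_cst _). Qed.

Lemma FP_orb b1 b2 : FP b1 -> FP b2 -> FP (fun e => b1 e || b2 e).
Proof. by move=> h1 h2; apply: FP_if h1 (FP_cst _) h2. Qed.

Lemma FP_negb b : FP b -> FP (fun e => ~~ b e).
Proof. by move=> h1; apply: FP_if h1 (FP_cst _) (FP_cst _). Qed.

Lemma FP_addn n1 n2 : FP n1 -> FP n2 -> FP (fun e => n1 e + n2 e).
Proof.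
move=> h1 h2; apply: (FP_ext (g := fun e => iter (n1 e) S (n2 e))).
  by move=> e; rewrite iter_succn addnC.
apply: (FP_iter (h := fun _ => S) (G := fun=> 1)) => //; last 2 first.
- exact: polyb_cst.
- by move=> _ m; rewrite !esz_nat addn1.
by apply: FP_succ; apply: FP_snd; apply: FP_id.
Qed.

Lemma FP_subn n1 n2 : FP n1 -> FP n2 -> FP (fun e => n1 e - n2 e).
Proof.
move=> h1 h2; apply: (FP_ext (g := fun e => iter (n2 e) predn (n1 e))).
  by move=> e; rewrite iter_predn.
apply: (FP_iter (h := fun _ => predn) (G := fun=> 1)) => //; last 2 first.
- exact: polyb_cst.
- by move=> _ m; rewrite !esz_nat; lia.
by apply: FP_pred; apply: FP_snd; apply: FP_id.
Qed.

End Ops.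

Section Ops2.

Variables (E A B : Type).
Context {eE : Enc E} {eA : Enc A} {eB : Enc B}.
Implicit Types (n : E -> nat) (s : E -> seq A).

Lemma FP_muln n1 n2 : FP n1 -> FP n2 -> FP (fun e => n1 e * n2 e).
Proof.
move=> h1 h2; apply: (FP_ext (g := fun e => iter (n1 e) (addn (n2 e)) 0)).
  by move=> e; rewrite iter_addn_0 mulnC.
apply: (FP_iter (h := fun e => addn (n2 e)) (G := n2)) => //; last 2 first.
- by apply: polyb_le (FP_size h2) => e; rewrite esz_nat.
- by move=> e m; rewrite !esz_nat addnC.
- apply: FP_addn; last by apply: FP_snd; apply: FP_id.
  by apply: (FP_comp h2); apply: FP_fst; apply: FP_id.
- exact: FP_cst.
Qed.

Lemma FP_leq n1 n2 : FP n1 -> FP n2 -> FP (fun e => n1 e <= n2 e).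
Proof.
move=> h1 h2; apply: (FP_ext (g := fun e => ~~ (0 < n1 e - n2 e))).
  by move=> e; lia.
by apply: FP_negb; apply: FP_lt0n; apply: FP_subn.
Qed.

Lemma FP_iota n1 : FP n1 -> FP (fun e => iota 0 (n1 e)).
Proof.
move=> h1.
have iterE m : iter m (fun t : seq nat => size t :: t) [::] = rev (iota 0 m).
  elim: m => // m IH.
  by rewrite iterS IH size_rev size_iota -addn1 iotaD rev_cat.
apply: (FP_ext (g := fun e => rev (iter (n1 e) (fun t : seq nat => size t :: t) [::]))).
  by move=> e; rewrite iterE revK.
apply: FP_rev; apply: (FP_iter_gen (h := fun _ t => size t :: t)
  (bd := fun e => n1 e * (n1 e).+1)) => //.
- have h2 : FP (fun x : E * seq nat => x.2) by apply: FP_snd; apply: FP_id.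
  apply: FP_cons => //.
  apply: (FP_ext (g := fun x => foldr (fun _ m => m.+1) 0 x.2)) => [x|].
    by elim: x.2 => //= _ s ->.
  apply: (FP_foldr (h := fun _ _ m => m.+1) (G := fun=> 1)) => //.
  + by apply: FP_succ; do 2 apply: FP_snd; apply: FP_id.
  + exact: FP_cst.
  + exact: polyb_cst.
  + by move=> _ _ m; rewrite !esz_nat addn1.
- exact: FP_cst.
- have hn : polyb n1 by apply: polyb_le (FP_size h1) => e; rewrite esz_nat.
  by apply: polyb_mul => //; apply: polyb_succ.
move=> e m hm; rewrite iterE esz_rev.
apply: leq_trans (esz_le_size (m := n1 e) _) _.
  by apply/allP => i; rewrite mem_iota esz_nat; lia.
by rewrite size_iota leq_mul2r hm orbT.
Qed.

Lemma FP_cat s1 s2 : FP s1 -> FP s2 -> FP (fun e => s1 e ++ s2 e).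
Proof.
move=> h1 h2; apply: (FP_ext (g := fun e => foldr cons (s2 e) (s1 e))).
  by move=> e; elim: (s1 e) => //= a s ->.
apply: (FP_foldr (h := fun _ => cons) (G := fun x => (esz x.2).+1)) => //.
- by apply: FP_cons; [apply: FP_fst; apply: FP_snd | do 2 apply: FP_snd];
    apply: FP_id.
- by apply: polyb_succ; exact: (FP_size (FP_snd (FP_id (A := (E * A)%type)))).
- by move=> e a s; rewrite esz_cons /=; lia.
Qed.

Lemma FP_head x0 s : FP s -> FP (fun e => head x0 (s e)).
Proof.
move=> h1; apply: (FP_ext (g := fun e => foldr (fun a _ => a) x0 (s e))).
  by move=> e; case: (s e).
apply: (FP_foldr (h := fun _ a _ => a) (G := fun x => esz x.2)) => //.
- by apply: FP_fst; apply: FP_snd; apply: FP_id.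
- exact: FP_cst.
- by exact: (FP_size (FP_snd (FP_id (A := (E * A)%type)))).
- by move=> e a b; apply: leq_addl.
Qed.

Lemma FP_drop n1 s : FP n1 -> FP s -> FP (fun e => drop (n1 e) (s e)).
Proof.
move=> h1 h2; apply: (FP_ext (g := fun e => iter (n1 e) behead (s e))).
  move=> e; elim: (n1 e) (s e) => [|n IH] t; first by rewrite drop0.
  by rewrite iterSr -IH -drop1 drop_drop addn1.
apply: (FP_iter (h := fun _ => behead) (G := fun=> 0)) => //.
- by apply: FP_behead; apply: FP_snd; apply: FP_id.
- exact: polyb_cst.
- by move=> _ [|a t] //; rewrite esz_cons /=; lia.
Qed.

Lemma FP_filter (h : E -> A -> bool) s :
  FP (fun x : E * A => h x.1 x.2) -> FP s -> FP (fun e => filter (h e) (s e)).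
Proof.
move=> hh h1.
apply: (FP_ext (g := fun e =>
  foldr (fun a t => if h e a then a :: t else t) [::] (s e))) => //.
apply: (FP_foldr (h := fun e a t => if h e a then a :: t else t)
  (G := fun x => (esz x.2).+1)) => //.
- have h2 : FP (fun x : E * (A * seq A) => x.2.1).
    by apply: FP_fst; apply: FP_snd; apply: FP_id.
  have h3 : FP (fun x : E * (A * seq A) => x.2.2).
    by do 2 apply: FP_snd; apply: FP_id.
  apply: FP_if (FP_cons h2 h3) h3.
  by apply: (FP_comp2 (h := h)) h2 => //; apply: FP_fst; apply: FP_id.
- exact: FP_cst.
- by apply: polyb_succ; exact: (FP_size (FP_snd (FP_id (A := (E * A)%type)))).
- by move=> e a t; case: ifP => _; rewrite ?esz_cons /=; lia.
Qed.

Lemma FP_has (h : E -> A -> bool) s :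
  FP (fun x : E * A => h x.1 x.2) -> FP s -> FP (fun e => has (h e) (s e)).
Proof.
move=> hh h1.
apply: (FP_ext (g := fun e => foldr (fun a b => h e a || b) false (s e))) => //.
apply: (FP_foldr (h := fun e a b => h e a || b) (G := fun=> 1)) => //.
- apply: FP_orb; last by do 2 apply: FP_snd; apply: FP_id.
  apply: (FP_comp2 (h := h)) => //; first by apply: FP_fst; apply: FP_id.
  by apply: FP_fst; apply: FP_snd; apply: FP_id.
- exact: FP_cst.
- exact: polyb_cst.
- by move=> e a b; rewrite !esz_bool; case: (_ || _); lia.
Qed.

End Ops2.

Section Ops3.

Variables (E A B : Type).
Context {eE : Enc E} {eA : Enc A} {eB : Enc B}.
Implicit Types (n : E -> nat) (s : E -> seq A).

Lemma FP_eqn n1 n2 : FP n1 -> FP n2 -> FP (fun e => n1 e == n2 e).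
Proof.
move=> h1 h2; apply: (FP_ext (g := fun e => (n1 e <= n2 e) && (n2 e <= n1 e))).
  by move=> e; rewrite eqn_leq.
by apply: FP_andb; apply: FP_leq.
Qed.

Lemma FP_nth x0 n s : FP s -> FP n -> FP (fun e => nth x0 (s e) (n e)).
Proof.
move=> h1 h2; apply: (FP_ext (g := fun e => head x0 (drop (n e) (s e)))).
  by move=> e; rewrite -nth0 nth_drop addn0.
by apply: FP_head; apply: FP_drop.
Qed.

Lemma FP_sizes s : FP s -> FP (fun e => size (s e)).
Proof.
move=> h1; apply: (FP_ext (g := fun e => foldr (fun _ m => m.+1) 0 (s e))).
  by move=> e; elim: (s e) => //= _ t ->.
apply: (FP_foldr (h := fun _ _ m => m.+1) (G := fun=> 1)) => //.
- by apply: FP_succ; do 2 apply: FP_snd; apply: FP_id.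
- exact: FP_cst.
- exact: polyb_cst.
- by move=> _ _ m; rewrite !esz_nat addn1.
Qed.

Lemma FP_rcons (f : E -> A) s : FP s -> FP f -> FP (fun e => rcons (s e) (f e)).
Proof.
move=> h1 h2; apply: (FP_ext (g := fun e => s e ++ [:: f e])).
  by move=> e; rewrite cats1.
by apply: FP_cat h1 (FP_cons h2 (FP_cst _)).
Qed.

Lemma FP_all (h : E -> A -> bool) s :
  FP (fun x : E * A => h x.1 x.2) -> FP s -> FP (fun e => all (h e) (s e)).
Proof.
move=> hh h1; apply: (FP_ext (g := fun e => ~~ has (fun a => ~~ h e a) (s e))).
  by move=> e; rewrite has_predC negbK.
apply: FP_negb; apply: (FP_has (h := fun e a => ~~ h e a)) => //.
exact: FP_negb.
Qed.

Lemma FP_flatten (s : E -> seq (seq A)) :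
  FP s -> FP (fun e => flatten (s e)).
Proof.
move=> h1.
apply: (FP_foldr (h := fun _ => cat) (G := fun x => esz x.2)) => //.
- by apply: FP_cat; [apply: FP_fst; apply: FP_snd | do 2 apply: FP_snd];
    apply: FP_id.
- exact: FP_cst.
- by exact: (FP_size (FP_snd (FP_id (A := (E * seq A)%type)))).
- by move=> e a t; rewrite esz_cat addnC.
Qed.

Lemma FP_nseq (a : A) n : FP n -> FP (fun e => nseq (n e) a).
Proof.
move=> h1; apply: (FP_ext (g := fun e => [seq a | _ <- nseq (n e) tt])).
  by move=> e; rewrite map_nseq.
by apply: (FP_map (h := fun _ _ => a)); [apply: FP_cst | apply: FP_ticks].
Qed.

Lemma FP_ffact n r : FP n -> FP (fun e => n e ^_ r).
Proof.
move=> h1; elim: r => [|r IH]; first exact: FP_cst.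
apply: (FP_ext (g := fun e => n e ^_ r * (n e - r))).
  by move=> e; rewrite ffactnSr.
by apply: FP_muln IH (FP_subn h1 (FP_cst _)).
Qed.

End Ops3.

Lemma FP_mem E {eE : Enc E} (n : E -> nat) (s : E -> seq nat) :
  FP n -> FP s -> FP (fun e => n e \in s e).
Proof.
move=> h1 h2; apply: (FP_ext (g := fun e => has (fun i => i == n e) (s e))).
  by move=> e; rewrite -has_pred1; apply: eq_has => i.
apply: (FP_has (h := fun e i => i == n e)) => //.
apply: FP_eqn; first exact: FP_proj2.
by apply: FP_comp h1 _; apply: FP_proj1.
Qed.

(* Redefined as further functions are shown to be polynomial. *)
Ltac fp_hook := fail.

Ltac fp_step := cbv beta; lazymatch goal with
  | |- FP (fun _ => ?c) => exact: FP_cst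
  | |- FP (fun e => e) => exact: FP_id
  | |- FP (@fst _ _) => exact: FP_proj1
  | |- FP (@snd _ _) => exact: FP_proj2
  | |- FP (fun e => (@?f e, @?g e)) => apply: (FP_pair (f := f) (g := g))
  | |- FP (fun e => fst (@?f e)) => apply: (FP_fst (f := f))
  | |- FP (fun e => snd (@?f e)) => apply: (FP_snd (f := f))
  | |- FP (fun e => @?f e :: @?g e) => apply: (FP_cons (f := f) (g := g))
  | |- FP (fun e => @?f e ++ @?g e) => apply: (FP_cat (s1 := f) (s2 := g))
  | |- FP (fun e => rcons (@?f e) (@?g e)) => apply: (FP_rcons (s := f) (f := g))
  | |- FP (fun e => flatten (@?f e)) => apply: (FP_flatten (s := f))
  | |- FP (fun e => size (@?f e)) => apply: (FP_sizes (s := f))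
  | |- FP (fun e => iota 0 (@?f e)) => apply: (FP_iota (n1 := f))
  | |- FP (fun e => nth ?x (@?f e) (@?g e)) =>
      apply: (FP_nth x (s := f) (n := g))
  | |- FP (fun e => S (@?f e)) => apply: (FP_succ (f := f))
  | |- FP (fun e => predn (@?f e)) => apply: (FP_pred (f := f))
  | |- FP (fun e => nseq (@?f e) ?a) => apply: (FP_nseq a (n := f))
  | |- FP (fun e => in_mem (@?f e) (mem (@?s e))) =>
      apply: (FP_mem (n := f) (s := s))
  | |- FP (fun e => @?f e + @?g e) => apply: (FP_addn (n1 := f) (n2 := g))
  | |- FP (fun e => @?f e - @?g e) => apply: (FP_subn (n1 := f) (n2 := g))
  | |- FP (fun e => @?f e * @?g e) => apply: (FP_muln (n1 := f) (n2 := g))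
  | |- FP (fun e => (@?f e) ^_ ?r) => apply: (FP_ffact (n := f) r)
  | |- FP (fun e => @?f e <= @?g e) => apply: (FP_leq (n1 := f) (n2 := g))
  | |- FP (fun e => @eq_op _ (@?f e) (@?g e)) =>
      apply: (FP_eqn (n1 := f) (n2 := g))
  | |- FP (fun e => @?f e && @?g e) => apply: (FP_andb (b1 := f) (b2 := g))
  | |- FP (fun e => @?f e || @?g e) => apply: (FP_orb (b1 := f) (b2 := g))
  | |- FP (fun e => ~~ @?f e) => apply: (FP_negb (b := f))
  | |- FP (fun e => if _ then _ else _) => refine (FP_if _ _ _)
  | |- FP (fun e => map (@?h e) (@?s e)) => apply: (FP_map (h := h) (l := s))
  | |- FP (fun e => filter (@?h e) (@?s e)) =>
      apply: (FP_filter (h := h) (s := s))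
  | |- FP (fun e => has (@?h e) (@?s e)) => apply: (FP_has (h := h) (s := s))
  | |- FP (fun e => all (@?h e) (@?s e)) => apply: (FP_all (h := h) (s := s))
  | _ => fp_hook
  end.

Ltac fp := repeat fp_step.

(** * Local search in subdivided bipartite graphs *)

Lemma dist_setD (T : finType) (A B : {set T}) : dist A B = #|A :\: B| + #|B :\: A|.
Proof.
rewrite /dist.
have := cardsUI A B; have := cardsID B A; have := cardsID A B.
by rewrite [B :&: A]setIC; lia.
Qed.

Lemma ltn_card_setD (T : finType) (A B : {set T}) :
  (#|A| < #|B|) = (#|A :\: B| < #|B :\: A|).
Proof.
by rewrite -(cardsID B A) -(cardsID A B) [B :&: A]setIC ltn_add2l.
Qed.

Lemma card_set_sum (A B : finType) (S : {set A + B}) :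
  #|S| = #|[set x | inl x \in S]| + #|[set y | inr y \in S]|.
Proof.
rewrite -(card_imset (mem [set x | inl x \in S]) (@inl_inj A B)).
rewrite -(card_imset (mem [set y | inr y \in S]) (@inr_inj A B)).
rewrite -cardsUI [X in _ + X](_ : _ = 0) ?addn0.
  congr #|pred_of_set _|; apply/setP => -[x|y]; rewrite inE.
    rewrite [X in _ || X](_ : _ = false) ?orbF; last by apply/imsetP => -[].
    apply/idP/imsetP => [h|[z]]; first by exists x; rewrite ?inE.
    by rewrite inE => h [->].
  rewrite [X in X || _](_ : _ = false) /=; last by apply/imsetP => -[].
  apply/idP/imsetP => [h|[z]]; first by exists y; rewrite ?inE.
  by rewrite inE => h [->].
apply/eqP; rewrite cards_eq0 -subset0; apply/subsetP => z.
by rewrite inE => /andP[/imsetP[x _ ->] /imsetP[]].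
Qed.

Definition nbrs (V : finType) (H : sgraph V) (T : {set V}) : {set V} :=
  [set y | [exists x in T, adj H x y]].

Section Swap.

Variables (V : finType) (H : sgraph V) (L : {set V}) (D q : nat).
Hypothesis bip : forall x y, adj H x y -> (x \in L) = (y \notin L).
Hypothesis degL : forall x, x \in L -> #|[set y | adj H x y]| = D.
Hypothesis q_gt0 : 0 < q.
Hypothesis degD : q <= 2 * D.

Local Notation arc := {a : V * V | adj H a.1 a.2}.
Local Notation U := (subdiv_vertex H).

Definition arc_rev (a : arc) : arc :=
  exist _ ((val a).2, (val a).1)
    (etrans (adj_sym H (val a).2 (val a).1) (valP a)).

Lemma arc_revK : involutive arc_rev.
Proof. by case=> -[x y] /= h; apply: val_inj. Qed.

Lemma arc_bip (a : arc) : ((val a).1 \in L) = ((val a).2 \notin L).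
Proof. exact: bip (valP a). Qed.

Definition start : {set U} := [set u : U |
  match u with inl x => x \in L | inr a => (val a).1 \notin L end].

Lemma start_cover : vertex_cover (subdiv2 H) start.
Proof.
move=> [x|a] [y|b] //=; rewrite !inE.
- by move=> /eqP <-; rewrite orbN.
- by move=> /eqP <-; rewrite orNb.
- by case/andP=> /eqP -> _; rewrite -arc_bip orbN.
Qed.

Section Cover.

Variable S : {set U}.

(** [T] and [A] record what [S] drops from [start], [J] and [B] what it adds. A dropped new vertex
    lies next to the right side; [A] holds the opposite arc, so that [A] and [B] both consist of
    arcs leaving [L] and can be compared. *)
Let T : {set V} := [set x in L | inl x \notin S].
Let J : {set V} := [set y | (y \notin L) && (inl y \in S)].
Let A : {set arc} := [set a | ((val a).1 \in L) && (inr (arc_rev a) \notin S)].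
Let B : {set arc} := [set a | ((val a).1 \in L) && (inr a \in S)].

Lemma card_gained : #|S :\: start| = #|J| + #|B|.
Proof.
rewrite card_set_sum; congr (_ + _); apply: eq_card => x; rewrite !inE //.
by rewrite negbK.
Qed.

Lemma card_lost : #|start :\: S| = #|T| + #|A|.
Proof.
rewrite card_set_sum; congr (_ + _).
  by apply: eq_card => x; rewrite !inE andbC.
rewrite -(card_imset (mem A) (inv_inj arc_revK)); apply: eq_card => a.
rewrite -{2}[a]arc_revK (mem_imset _ _ (inv_inj arc_revK)) !inE arc_revK.
by rewrite (arc_bip a) negbK andbC.
Qed.

End Cover.

Lemma card_out_arcs (T : {set V}) : T \subset L ->
  #|[set a : arc | (val a).1 \in T]| = D * #|T|.
Proof.
move=> TL; rewrite -sum1_card (partition_big (fun a => (val a).1) (mem T)) /=;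
  last by move=> a; rewrite inE.
rewrite mulnC -sum_nat_const; apply: eq_bigr => x xT.
rewrite sum1_card -(degL (subsetP TL x xT)).
transitivity #|[set (val a).2 | a : arc in [set a : arc | (val a).1 == x]]|.
  rewrite card_in_imset; last first.
    move=> [[? y] h] [[? z] h']; rewrite !inE /= => /eqP ? /eqP ? /= ?; subst.
    exact: val_inj.
  apply: eq_card => a; rewrite [LHS]unfold_in !inE /= andb_idl // => /eqP ->; exact: xT.
apply: eq_card => y; rewrite inE; apply/imsetP/idP => [[[[? z] h]]|xy].
  by rewrite inE /= => /eqP ? ->; subst.
by exists (exist _ (x, y) xy); rewrite ?inE.
Qed.

Lemma swap_sound (S : {set U}) : vertex_cover (subdiv2 H) S ->
  dist start S <= 2 * q * D + 2 * q - 1 -> #|S| < #|start| ->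
  exists T : {set V}, [/\ T \subset L, #|T| <= q & #|nbrs H T| < #|T|].
Proof.
move=> covS; rewrite dist_setD ltn_card_setD card_gained card_lost.
set T := [set x in L | _]; set A := [set a | _ && (inr (arc_rev a) \notin S)].
set J := [set y | _ && (inl y \in S)]; set B := [set a | _ && (inr a \in S)].
move=> hd hlt.
have inT x : (x \in T) = (x \in L) && (inl x \notin S) by rewrite inE.
have inJ y : (y \in J) = (y \notin L) && (inl y \in S) by rewrite inE.
have inA a : (a \in A) = ((val a).1 \in L) && (inr (arc_rev a) \notin S).
  by rewrite inE.
have inB a : (a \in B) = ((val a).1 \in L) && (inr a \in S) by rewrite inE.
clearbody T J A B.
have TL : T \subset L by apply/subsetP => x; rewrite inT => /andP[].
have cov (a : arc) : (val a).1 \in T -> inr a \in S.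
  rewrite inT => /andP[_ h]; have := covS (inl (val a).1) (inr a) (eqxx _).
  by rewrite (negbTE h).
have hA : A \subset B.
  apply/subsetP => a; rewrite inA inB => /andP[-> h] /=.
  have := covS (inr a) (inr (arc_rev a)); rewrite /= !eqxx => /(_ isT).
  by rewrite (negbTE h) orbF.
have hTB : D * #|T| <= #|B|.
  rewrite -card_out_arcs //; apply: subset_leq_card; apply/subsetP => a.
  by rewrite in_set inB => aT; rewrite (cov a aT) andbT (subsetP TL).
(* Arcs from [T] to right vertices outside [S]. The new vertex at the right end of such an arc must
   be in [S], so [F] is disjoint from [A], while both lie in [B]. Every neighbour of [T] is in [J]
   or is the end of an arc of [F]; hence the gain [#|T| + #|A| - #|J| - #|B|] is at most
   [#|T| - #|nbrs H T|]. *)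
pose F := [set a : arc | ((val a).1 \in T) && ((val a).2 \notin J)].
have inF a : (a \in F) = ((val a).1 \in T) && ((val a).2 \notin J).
  by rewrite inE.
clearbody F.
have hF : #|F| + #|A| <= #|B|.
  have -> : #|F| + #|A| = #|F :|: A|.
    rewrite -cardsUI [F :&: A](_ : _ = set0) ?cards0 ?addn0 //.
    apply/setP => a; rewrite [in RHS]inE; apply/negbTE/negP.
    rewrite in_setI inF inA => /andP[/andP[aT aJ] /andP[aL]].
    have := covS (inl (val a).2) (inr (arc_rev a)) (eqxx _).
    by move: aJ; rewrite inJ -arc_bip aL /= => /negbTE -> /= ->.
  apply: subset_leq_card; rewrite subUset hA andbT; apply/subsetP => a.
  by rewrite inF inB => /andP[aT _]; rewrite (cov a aT) (subsetP TL).
have hN : #|nbrs H T| <= #|J| + #|F|.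
  apply: leq_trans (_ : #|J :|: [set (val a).2 | a in F]| <= _).
    apply: subset_leq_card; apply/subsetP => y.
    rewrite in_set => /existsP[x /andP[xT xy]]; rewrite in_setU.
    have [//|yJ] := boolP (y \in J).
    by apply/imsetP; exists (exist _ (x, y) xy); rewrite // inF /= xT.
  apply: leq_trans (_ : #|J| + #|[set (val a).2 | a in F]| <= _).
    by rewrite -cardsUI leq_addr.
  by rewrite leq_add2l leq_imset_card.
have hJF : #|J| + #|F| < #|T|.
  by rewrite -(ltn_add2r #|A|) -addnA; apply: leq_ltn_trans hlt; rewrite leq_add2l.
exists T; split=> //; last exact: leq_ltn_trans hN hJF.
(* If [#|T| > q], then [B] has at least [D * (q + 1)] arcs and, as shown next, [J] has at least [D]
   vertices. The swap is improving, so the distance exceeds twice [#|J| + #|B|], hence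
   [2 * D * (q + 2)], which is beyond the budget by [q <= 2 * D]. *)
rewrite leqNgt; apply/negP => hq.
(* Some element of [T] contributes no arc to [F]: its neighbours are all in [J]. *)
have [x xT xF] : exists2 x, x \in T & x \notin [set (val a).1 | a in F].
  apply/subsetPn; apply/negP => /subset_leq_card h.
  have := leq_trans h (leq_imset_card _ _); rewrite leqNgt => /negP; apply.
  exact: leq_ltn_trans (leq_addl _ _) hJF.
have : D <= #|J|.
  rewrite -(degL (subsetP TL x xT)); apply: subset_leq_card; apply/subsetP => y.
  rewrite inE => xy; apply: contraNT xF => yJ.
  by apply/imsetP; exists (exist _ (x, y) xy); rewrite // inF /= xT.
have : D * q.+1 <= D * #|T| by rewrite leq_mul2l hq orbT.
move: (#|T|) (#|J|) (#|A|) (#|B|) hd hlt hTB degD q_gt0 => t j a b.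
by rewrite mulnS -mulnA [D * q]mulnC; lia.
Qed.

(** Origin of the budget: [T] leaves, its at most [#|T| - 1] neighbours enter, and on each of the
    [D * #|T|] edges at [T] the two new vertices change roles. For [#|T| = q] this sums to
    [2 * q * D + 2 * q - 1]. *)
Lemma swap_complete (T : {set V}) : T \subset L -> #|T| <= q ->
  #|nbrs H T| < #|T| -> exists S : {set U}, [/\ vertex_cover (subdiv2 H) S,
    dist start S <= 2 * q * D + 2 * q - 1 & #|S| < #|start|].
Proof.
move=> TL hq hN.
have outL x y : x \in T -> adj H x y -> y \notin L.
  by move=> xT /bip <-; apply: (subsetP TL).
have NL y : y \in nbrs H T -> y \notin L.
  by rewrite inE => /existsP[x /andP[xT]]; apply: outL.
pose S := [set u : U | match u with
  | inl x => (x \in L :\: T) || (x \in nbrs H T)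
  | inr a => ((val a).1 \in T) || (((val a).1 \notin L) && ((val a).2 \notin T))
  end].
have ES : [set x in L | inl x \notin S] = T.
  apply/setP => x; rewrite !in_set /= negb_or negb_and negbK.
  have [xT|xT] := boolP (x \in T).
    rewrite (subsetP TL x xT) /=; apply/negP => h.
    by have := NL x; rewrite inE h (subsetP TL x xT) => /(_ isT).
  by case: (x \in L).
have EJ : [set y | (y \notin L) && (inl y \in S)] = nbrs H T.
  apply/setP => y; rewrite in_set [inl y \in S]in_set.
  have [yN|yN] := boolP (y \in nbrs H T); first by rewrite orbT NL.
  by rewrite orbF in_setD; case: (y \in L); rewrite ?andbF.
have EB : [set a : arc | ((val a).1 \in L) && (inr a \in S)]
    = [set a : arc | (val a).1 \in T].
  apply/setP => a; rewrite !in_set.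
  have [aT|aT] := boolP ((val a).1 \in T); first by rewrite (subsetP TL).
  by rewrite /=; case: (_ \in L).
have EA : [set a : arc | ((val a).1 \in L) && (inr (arc_rev a) \notin S)]
    = [set a : arc | (val a).1 \in T].
  apply/setP => a; rewrite !in_set /=.
  have [aT|aT] := boolP ((val a).1 \in T).
    rewrite (subsetP TL _ aT) /= andbF orbF; apply/negP => /(subsetP TL).
    by apply/negP; rewrite -arc_bip (subsetP TL).
  rewrite /= andbT negb_or -arc_bip.
  by case: (_ \in L); rewrite ?andbF.
exists S; split.
- have key a : (val a).1 \notin L -> (inl (val a).1 \in S) || (inr a \in S).
    move=> aL; have aT1 : ((val a).1 \in T) = false.
      by apply: contraNF aL; apply: (subsetP TL).
    rewrite !in_set (negbTE aL) aT1 /= orbC -implyNb negbK; apply/implyP => aT.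
    by apply/existsP; exists (val a).2; rewrite aT adj_sym (valP a).
  have key2 a : (val a).1 \in L -> (inl (val a).1 \in S) || (inr a \in S).
    by move=> aL; rewrite !in_set aL; case: (_ \in T); rewrite ?orbT.
  have key3 a : (inl (val a).1 \in S) || (inr a \in S).
    by case: (boolP ((val a).1 \in L)) => [/key2|/key].
  move=> [x|a] [y|b] //=.
  + by move=> /eqP <-; apply: key3.
  + by move=> /eqP <-; rewrite orbC; apply: key3.
  case/andP=> /eqP e1 /eqP e2; rewrite !in_set -e1 -e2.
  have := arc_bip a; case: ((val a).1 \in T) => //=.
  case: ((val a).2 \in T) => //=; first by rewrite orbT.
  by case: (_ \in L); case: (_ \in L).
- by rewrite dist_setD card_gained card_lost ES EJ EB EA card_out_arcs //; nia.
- by rewrite ltn_card_setD card_gained card_lost ES EJ EB EA ltn_add2r.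
Qed.

End Swap.

(** * Counting tuples against their neighbours *)

(** Strict growth of [s ^_ r - s], in the form needed later: [s ^_ r] tuples over [s < K] nodes do
    not outnumber their [s + (K ^_ r - K - 1)] neighbours. *)
Lemma ffact_gap r s K : 1 < r <= s -> s < K -> s ^_ r + K < K ^_ r + s.
Proof.
case: r => // r /andP[r1 rs]; elim: K => // K IH; rewrite ltnS => sK.
have step : K.+1 ^_ r.+1 = K ^_ r * r.+1 + K ^_ r.+1.
  by rewrite ffactSS ffactnSr mulnC -mulnDr; congr (_ * _); lia.
have pos : 0 < K ^_ r by rewrite ffact_gt0; lia.
have [->|neq] := eqVneq s K; first by rewrite step; nia.
by have := IH ltac:(lia); rewrite step; nia.
Qed.

Lemma leq_ffact2 r K : 1 < r <= K -> K * K.-1 <= K ^_ r.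
Proof.
case: r => // -[//|r] /andP[_ rK].
by rewrite !ffactnS mulnA leq_pmulr // ffact_gt0; lia.
Qed.

Section Hall.

Variables (nw np r K : nat) (L : seq (seq nat)).
(** Numbering of the bipartite graph: the tuples of [L], then the [nw] nodes, then the [np] vertices
    joined to all tuples. It is a function on plain numbers because the reduction program evaluates
    it too. *)
Definition link (x y : nat) : bool :=
  [&& x < size L, size L <= y &
      (y - size L \in nth [::] L x) || (size L + nw <= y)].

Local Notation h := (size L + (nw + np)).

Definition inc_rel (x y : 'I_h) : bool := link x y || link y x.

Lemma inc_sym : symmetric inc_rel.
Proof. by move=> x y; rewrite /inc_rel orbC. Qed.

Lemma inc_irr : irreflexive inc_rel.
Proof. by move=> x; rewrite /inc_rel orbb /link; case: ltnP. Qed.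

Definition incidence : sgraph 'I_h := SGraph inc_sym inc_irr.

Definition left_side : {set 'I_h} := [set x : 'I_h | x < size L].

Lemma inc_bip x y : adj incidence x y -> (x \in left_side) = (y \notin left_side).
Proof. by rewrite /= /inc_rel /link !inE; lia. Qed.

Hypothesis r_gt1 : 1 < r.
Hypothesis rK : r < K.
Hypothesis npE : np = K ^_ r - K - 1.
Hypothesis L_uniq : uniq L.
Hypothesis L_tuple :
  forall t, t \in L -> [/\ size t = r, uniq t & all (fun w => w < nw) t].

Lemma np_gt1 : 1 < np.
Proof. by have := @leq_ffact2 r K ltac:(lia); rewrite npE; nia. Qed.

Definition right (u : 'I_nw + 'I_np) : 'I_h := rshift (size L) (unsplit u).

Lemma right_inj : injective right.
Proof. by apply: inj_comp; [apply: rshift_inj | apply: can_inj unsplitK]. Qed.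

Lemma rightP (x : 'I_h) : x \notin left_side -> exists u, x = right u.
Proof.
rewrite inE -leqNgt => hx; have lt : x - size L < nw + np by have := ltn_ord x; lia.
exists (split (Ordinal lt)); apply: val_inj; rewrite /right splitK /=; lia.
Qed.

Lemma adj_right (x : 'I_h) u : x \in left_side ->
  adj incidence x (right u) = if u is inl w then val w \in nth [::] L x else true.
Proof.
rewrite inE /= /inc_rel /link /right => xl; case: u => u /=.
  by rewrite xl addKn; have := ltn_ord u; case: (_ \in _); lia.
by rewrite xl; case: (_ \in _); lia.
Qed.

Lemma nth_tuple (x : 'I_h) : x \in left_side ->
  {t : r.-tuple 'I_nw | map val t = nth [::] L x & uniq t}.
Proof.
rewrite inE => xl; have /L_tuple[sz un lt] := mem_nth [::] xl.
have [t tE] : {t : seq 'I_nw | map val t = nth [::] L x}.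
  exists (pmap insub (nth [::] L x)).
  by rewrite (pmap_filter (insubK _)); apply/all_filterP; apply: sub_all lt => w;
    rewrite isSome_insub.
have szt : size t == r by rewrite -(size_map val) tE sz.
by exists (Tuple szt) => //=; rewrite -(map_inj_uniq val_inj) tE.
Qed.

Lemma inc_deg x : x \in left_side ->
  #|[set y | adj incidence x y]| = r + np.
Proof.
move=> xl; have [t tE tU] := nth_tuple xl.
rewrite -{1}(size_tuple t) -(card_uniqP tU) -[in RHS](card_ord np).
pose Y : {set 'I_nw + 'I_np} := [set u | if u is inl w then w \in t else true].
transitivity #|right @: Y|.
  apply: eq_card => y; rewrite inE; apply/idP/imsetP.
    move=> xy; have [u yE] : exists u, y = right u.
      by apply: rightP; rewrite -(inc_bip xy).
    exists u => //; move: xy; rewrite yE adj_right // inE; case: u {yE} => // w.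
    by rewrite -tE mem_map //; apply: val_inj.
  move=> [u]; rewrite inE => hu ->; rewrite adj_right //.
  by case: u hu => // w; rewrite -tE mem_map //; apply: val_inj.
rewrite card_imset; last exact: right_inj.
rewrite card_set_sum; congr (_ + _); apply: eq_card => u; rewrite !inE //.
Qed.

Lemma nbrs_sub (T : {set 'I_h}) (Q : {set 'I_nw}) :
  T \subset left_side ->
  (forall x w, x \in T -> val w \in nth [::] L x -> w \in Q) ->
  #|nbrs incidence T| <= #|Q| + np.
Proof.
move=> TL hQ.
pose Y : {set 'I_nw + 'I_np} := [set u | if u is inl w then w \in Q else true].
have <- : #|Y| = #|Q| + np.
  rewrite card_set_sum -[in RHS](card_ord np).
  by congr (_ + _); apply: eq_card => u; rewrite !inE.
rewrite -(card_imset (mem Y) right_inj); apply: subset_leq_card.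
apply/subsetP => y; rewrite inE => /existsP[x /andP[xT xy]].
have xl := subsetP TL x xT.
have [u yE] : exists u, y = right u by apply: rightP; rewrite -(inc_bip xy).
apply/imsetP; exists u => //; move: xy; rewrite yE adj_right // inE.
by case: u {yE} => // w; apply: hQ.
Qed.

Lemma nbrs_sup (T : {set 'I_h}) (Q : {set 'I_nw}) (x0 : 'I_h) :
  x0 \in T -> T \subset left_side ->
  (forall w, w \in Q -> exists2 x, x \in T & val w \in nth [::] L x) ->
  #|Q| + np <= #|nbrs incidence T|.
Proof.
move=> x0T TL hQ.
pose Y : {set 'I_nw + 'I_np} := [set u | if u is inl w then w \in Q else true].
have <- : #|Y| = #|Q| + np.
  rewrite card_set_sum -[in RHS](card_ord np).
  by congr (_ + _); apply: eq_card => u; rewrite !inE.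
rewrite -(card_imset (mem Y) right_inj); apply: subset_leq_card.
apply/subsetP => y /imsetP[u]; rewrite inE => hu ->; rewrite inE.
apply/existsP; case: u hu => [w /hQ[x xT wx]|p _].
  by exists x; rewrite xT adj_right // (subsetP TL).
by exists x0; rewrite x0T adj_right // (subsetP TL).
Qed.

Lemma h_gt0 : 0 < h. Proof. by have := np_gt1; lia. Qed.

Definition lnum (t : r.-tuple 'I_nw) : 'I_h :=
  insubd (Ordinal h_gt0) (index (map val t) L).

Lemma val_lnum t : val (lnum t) = index (map val t) L.
Proof.
rewrite val_insubd ifT //.
apply: leq_ltn_trans (index_size _ _) _.
rewrite -[X in X < _]addn0 ltn_add2l addn_gt0; have := np_gt1.
by case: np => // *; rewrite orbT.
Qed.

Lemma nth_lnum (t : r.-tuple 'I_nw) : map val t \in L ->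
  nth [::] L (lnum t) = map val t.
Proof. by move=> tL; rewrite val_lnum nth_index. Qed.

Lemma nth_lnumK (x : 'I_h) (t : r.-tuple 'I_nw) : x \in left_side ->
  map val t = nth [::] L x -> lnum t = x.
Proof.
by rewrite inE => xl tE; apply: val_inj; rewrite val_lnum tE index_uniq.
Qed.

Lemma card_tuples_in (Q : {set 'I_nw}) :
  #|[set t : r.-tuple 'I_nw | all (mem Q) t & uniq t]| = #|Q| ^_ r.
Proof. exact: (card_uniq_tuples r (mem Q)). Qed.

Definition hyperclique (Q : {set 'I_nw}) : Prop :=
  forall t : r.-tuple 'I_nw, uniq t -> all (mem Q) t -> map val t \in L.

(** For the set [Q] of nodes met by [T], [#|Q| + np < #|T| <= #|Q| ^_ r]. The bound [#|T| <= K ^_ r]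
    gives [#|Q| <= K], the growth of [s ^_ r - s] excludes [#|Q| < K], and for [#|Q| = K] no slack
    remains: [T] consists of all tuples over [Q]. *)
Lemma hall_sound (T : {set 'I_h}) : T \subset left_side ->
  #|T| <= K ^_ r -> #|nbrs incidence T| < #|T| ->
  exists2 Q : {set 'I_nw}, #|Q| = K & hyperclique Q.
Proof.
move=> TL hTq hNT.
have [x0 x0T] : exists x0, x0 \in T by apply/card_gt0P; lia.
pose Q := [set w : 'I_nw | [exists x in T, val w \in nth [::] L x]].
have hQ : #|Q| + np <= #|nbrs incidence T|.
  apply: nbrs_sup x0T TL _ => w; rewrite inE => /existsP[x /andP[xT wx]].
  by exists x.
have hQT : #|Q| + np < #|T| by apply: leq_ltn_trans hQ hNT.
pose F := [set t : r.-tuple 'I_nw | [exists x in T, map val t == nth [::] L x]].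
have FQ : F \subset [set t : r.-tuple 'I_nw | all (mem Q) t & uniq t].
  apply/subsetP => t; rewrite !inE => /existsP[x /andP[xT /eqP tE]].
  apply/andP; split.
    apply/allP => w wt; rewrite /= inE; apply/existsP; exists x.
    by rewrite xT -tE map_f.
  have := subsetP TL x xT; rewrite inE => xl.
  have /L_tuple[_ un _] := mem_nth [::] xl.
  by rewrite -(map_inj_uniq val_inj) tE.
have TF : #|T| <= #|F|.
  apply: leq_trans (leq_imset_card lnum (mem F)); apply: subset_leq_card.
  apply/subsetP => x xT; have [t tE _] := nth_tuple (subsetP TL x xT).
  apply/imsetP; exists t; last by rewrite (nth_lnumK _ tE) // (subsetP TL).
  by rewrite inE; apply/existsP; exists x; rewrite xT tE eqxx.
have FQc := subset_leq_card FQ; rewrite card_tuples_in in FQc.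
have rQ : r <= #|Q|.
  by rewrite -ffact_gt0; apply: leq_trans FQc; apply: leq_trans TF; lia.
have KQ : #|Q| = K.
  have := np_gt1; have := npE; have := leq_trans hQT (leq_trans TF FQc).
  case: (ltngtP #|Q| K) => // hlt.
    have := @ffact_gap r #|Q| K ltac:(lia) hlt.
    by move: (#|Q| ^_ r) (K ^_ r) (#|Q|) => a b s; lia.
  by have := leq_trans hQT hTq; lia.
exists Q => // t tU tQ.
have : t \in [set t : r.-tuple 'I_nw | all (mem Q) t & uniq t] by rewrite inE tQ.
have -> : [set t : r.-tuple 'I_nw | all (mem Q) t & uniq t] = F.
  apply/esym/eqP; rewrite eqEcard FQ card_tuples_in KQ; have := np_gt1.
  by have := npE; have := leq_trans hQT TF; rewrite KQ; lia.
rewrite inE => /existsP[x /andP[xT /eqP ->]]; apply: mem_nth.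
by have := subsetP TL x xT; rewrite inE.
Qed.

Lemma hall_complete (Q : {set 'I_nw}) : #|Q| = K -> hyperclique Q ->
  exists T : {set 'I_h}, [/\ T \subset left_side, #|T| <= K ^_ r &
    #|nbrs incidence T| < #|T|].
Proof.
move=> QK hQ; pose F := [set t : r.-tuple 'I_nw | all (mem Q) t & uniq t].
have FL t : t \in F -> map val t \in L.
  by rewrite inE => /andP[tQ tU]; apply: hQ.
have cT : #|lnum @: F| = K ^_ r.
  rewrite card_in_imset ?card_tuples_in ?QK // => t u /FL tL /FL uL tu.
  apply: val_inj; apply: (inj_map val_inj).
  by rewrite -nth_lnum // tu nth_lnum.
have TL : lnum @: F \subset left_side.
  by apply/subsetP => _ /imsetP[t /FL tL ->]; rewrite inE val_lnum index_mem.
exists (lnum @: F); split=> //; first by rewrite cT.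
rewrite cT; apply: leq_ltn_trans (nbrs_sub (Q := Q) TL _) _; last first.
  by have := np_gt1; have := npE; rewrite QK; lia.
move=> _ w /imsetP[t tF ->]; rewrite nth_lnum ?FL // mem_map; last exact: val_inj.
by move: tF; rewrite inE => /andP[/allP h _]; apply: h.
Qed.

End Hall.

(** * Transport of local search along isomorphisms and to bit strings *)

Definition improvable (V : finType) (G : sgraph V) (S : {set V}) (k : nat) : Prop :=
  exists S' : {set V}, [/\ vertex_cover G S', dist S S' <= k & #|S'| < #|S|].

Lemma improvable_iso (V W : finType) (G : sgraph V) (H : sgraph W)
    (f : V -> W) (S : {set V}) k :
  bijective f -> (forall x y, adj H (f x) (f y) = adj G x y) ->
  improvable G S k -> improvable H (f @: S) k.
Proof.
move=> bf fE [S' [cov hd hlt]].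
have inj : injective f := bij_inj bf.
exists (f @: S'); split; last by rewrite !card_imset.
  case: bf => g fK gK x y; rewrite -[x]gK -[y]gK fE !mem_imset //.
  exact: cov.
by rewrite /dist -imsetU -imsetI ?card_imset //; apply: in2W.
Qed.

Lemma improvable_isoE (V W : finType) (G : sgraph V) (H : sgraph W)
    (f : V -> W) (S : {set V}) k :
  bijective f -> (forall x y, adj H (f x) (f y) = adj G x y) ->
  improvable G S k <-> improvable H (f @: S) k.
Proof.
move=> bf fE; split; first exact: improvable_iso.
case: (bf) => g fK gK; have gE x y : adj G (g x) (g y) = adj H x y.
  by rewrite -fE !gK.
move=> /(improvable_iso (Bijective gK fK) gE).
by rewrite -imset_comp (eq_imset (g := id)) ?imset_id // => x /=; rewrite fK.
Qed.

Lemma code_nat_cat_inj m n s t :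
  code_nat m ++ s = code_nat n ++ t -> m = n /\ s = t.
Proof.
rewrite /code_nat; elim: m n => [|m IH] [|n] //= [].
  by move=> ->.
by move=> /IH [-> ->].
Qed.

Lemma allpairs_inj (S T U : eqType) (f g : S -> T -> U) (s : seq S) (t : seq T) :
  [seq f x y | x <- s, y <- t] = [seq g x y | x <- s, y <- t] ->
  forall x y, x \in s -> y \in t -> f x y = g x y.
Proof.
elim: s => //= a s IH /eqP; rewrite eqseq_cat ?size_map // => /andP[/eqP h1 /eqP h2].
move=> x y; rewrite inE => /orP[/eqP->|xs] yt; last exact: IH.
by move/eq_in_map: h1 => ->.
Qed.

(** [is_yes] only asserts that some graph with the given code can be improved; this lemma makes it a
    statement about the intended graph. The unary prefix delimits itself, and its value fixes the
    lengths of the two blocks behind it. *)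
Lemma code_graph_set_inj n (G : sgraph 'I_n) S n' (G' : sgraph 'I_n') S' k :
  code_graph_set G S = code_graph_set G' S' ->
  improvable G S k -> improvable G' S' k.
Proof.
rewrite /code_graph_set => /code_nat_cat_inj[En]; subst n' => /eqP.
rewrite eqseq_cat ?size_allpairs // => /andP[/eqP/allpairs_inj hG /eqP hS].
have -> : S' = S.
  by apply/setP => i; move/eq_in_map: hS => ->; rewrite ?mem_enum.
move=> [S1 [cov hd hlt]]; exists S1; split=> // x y; rewrite -hG ?mem_enum //.
exact: cov.
Qed.

Definition subdiv_codes (h : nat) (e : nat -> nat -> bool) : seq (nat * nat) :=
  [seq (x, y) | x <- iota 0 h, y <- [seq y <- iota 0 h | (x == y) || e x y]].

(* The pair (x, x) codes the original vertex x, and (x, y) with x <> y the new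
   vertex next to x on the subdivided edge xy. *)
Definition code_adj (u v : nat * nat) : bool :=
  if u.1 == u.2 then (v.1 != v.2) && (v.1 == u.1)
  else if v.1 == v.2 then u.1 == v.1
  else (u.1 == v.2) && (u.2 == v.1).

Definition code_start (nl : nat) (u : nat * nat) : bool :=
  if u.1 == u.2 then u.1 < nl else nl <= u.1.

Definition graph_bits (vs : seq (nat * nat)) (nl : nat) : seq bool :=
  code_nat (size vs) ++ ([seq code_adj u v | u <- vs, v <- vs] ++
  [seq code_start nl u | u <- vs]).

Section Coding.

Variables (h nl : nat) (e : nat -> nat -> bool) (H : sgraph 'I_h).
Hypothesis HE : forall x y : 'I_h, adj H x y = e x y.

Local Notation vs := (subdiv_codes h e).
Local Notation n := (size vs).

Definition vcode (u : subdiv_vertex H) : nat * nat :=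
  match u with inl x => (val x, val x) | inr a => (val (val a).1, val (val a).2) end.

Lemma arc_neq (a : {a : 'I_h * 'I_h | adj H a.1 a.2}) :
  ((val a).1 == (val a).2 :> nat) = false.
Proof.
apply/negP => /eqP/val_inj eq12; have := valP a.
by rewrite eq12 adj_irr.
Qed.

Lemma vcode_inj : injective vcode.
Proof.
move=> [x|a] [y|b] //=.
- by case=> /val_inj ->.
- by case=> e1 e2; have := arc_neq b; rewrite -e1 -e2 eqxx.
- by case=> e1 e2; have := arc_neq a; rewrite e1 e2 eqxx.
- case: a b => [[x y] p] [[x' y'] q] /= [/val_inj ? /val_inj ?]; subst.
  by congr inr; apply: val_inj.
Qed.

Lemma vcode_mem u : vcode u \in vs.
Proof.
apply/allpairsPdep; case: u => [x|a] /=.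
  by exists x, x; rewrite mem_filter eqxx !mem_iota add0n ltn_ord.
exists (val (val a).1), (val (val a).2).
by rewrite mem_filter -HE (valP a) orbT !mem_iota !add0n !ltn_ord.
Qed.

Lemma vcode_surj p : p \in vs -> exists u, vcode u = p.
Proof.
move=> /allpairsPdep[x [y []]]; rewrite mem_filter !mem_iota !add0n /=.
move=> xh /andP[exy yh] ->.
have [exy'|nxy] := eqVneq x y; first by exists (inl (Ordinal xh)); rewrite -exy'.
have xy : adj H (Ordinal xh) (Ordinal yh) by move: exy; rewrite HE (negbTE nxy).
by exists (inr (exist _ (Ordinal xh, Ordinal yh) xy)).
Qed.

Lemma vs_uniq : uniq vs.
Proof.
apply: allpairs_uniq_dep; first exact: iota_uniq.
  by move=> x _; apply: filter_uniq; apply: iota_uniq.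
by move=> [x y] [x' y'] _ _ [-> ->].
Qed.

Lemma vnum_proof u : index (vcode u) vs < n.
Proof. by rewrite index_mem vcode_mem. Qed.

Definition vnum (u : subdiv_vertex H) : 'I_n := Ordinal (vnum_proof u).

Lemma vnumK u : nth (0, 0) vs (vnum u) = vcode u.
Proof. by rewrite nth_index // vcode_mem. Qed.

Lemma vnum_bij : bijective vnum.
Proof.
have inj : injective vnum.
  by move=> u v uv; apply: vcode_inj; rewrite -!vnumK uv.
apply: (inj_card_bij inj); rewrite -(card_codom inj); apply: subset_leq_card.
apply/subsetP => i _; have /vcode_surj[u uE] := mem_nth (0, 0) (ltn_ord i).
apply/codomP; exists u; apply: val_inj.
by rewrite /= uE index_uniq // vs_uniq.
Qed.

Lemma code_adj_vcode u v : code_adj (vcode u) (vcode v) = adj (subdiv2 H) u v.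
Proof.
rewrite /code_adj; case: u v => [x|a] [y|b] /=; rewrite ?eqxx ?arc_neq //=.
Qed.

Definition num_adj (i j : 'I_n) : bool :=
  code_adj (nth (0, 0) vs i) (nth (0, 0) vs j).

Lemma num_adjE u v : num_adj (vnum u) (vnum v) = adj (subdiv2 H) u v.
Proof. by rewrite /num_adj !vnumK code_adj_vcode. Qed.

Lemma num_adj_sym : symmetric num_adj.
Proof.
have [g gK Kg] := vnum_bij.
by move=> i j; rewrite -[i]Kg -[j]Kg !num_adjE adj_sym.
Qed.

Lemma num_adj_irr : irreflexive num_adj.
Proof. by have [g gK Kg] := vnum_bij; move=> i; rewrite -[i]Kg num_adjE adj_irr. Qed.

Definition num_graph : sgraph 'I_n := SGraph num_adj_sym num_adj_irr.

Definition num_start : {set 'I_n} := [set i : 'I_n | code_start nl (nth (0, 0) vs i)].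

Lemma graph_bitsE : graph_bits vs nl = code_graph_set num_graph num_start.
Proof.
have enumE (T : Type) (f : nat * nat -> T) :
    [seq f u | u <- vs] = map (fun i : 'I_n => f (nth (0, 0) vs i)) (enum 'I_n).
  rewrite -{1}[vs](mkseq_nth (0, 0)) /mkseq -map_comp -val_enum_ord -map_comp.
  exact: eq_map.
rewrite /graph_bits /code_graph_set; congr (_ ++ (_ ++ _)).
  rewrite enumE; congr flatten; apply: eq_map => i /=.
  by rewrite enumE.
by rewrite enumE; apply: eq_map => i; rewrite inE.
Qed.

Lemma num_two_subdivided : two_subdivided num_graph.
Proof.
exists 'I_h, H; case: vnum_bij => g gK Kg; exists g; first by exists vnum.
by move=> i j; rewrite -num_adjE !Kg.
Qed.

Local Notation L := [set x : 'I_h | x < nl].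

Lemma num_startE : num_start = vnum @: start H L.
Proof.
apply/setP => i; have [g gK Kg] := vnum_bij; rewrite -[i]Kg.
rewrite mem_imset; last exact: can_inj gK.
rewrite !inE /code_start vnumK; case: (g i) => [x|a] /=.
  by rewrite eqxx inE.
by rewrite arc_neq inE -leqNgt.
Qed.

Lemma num_start_cover : (forall x y, adj H x y -> (x \in L) = (y \notin L)) ->
  vertex_cover num_graph num_start.
Proof.
move=> bip x y xy; have [g gK Kg] := vnum_bij.
have := @start_cover _ _ _ bip (g x) (g y); rewrite -num_adjE !Kg => /(_ xy).
have inj := can_inj gK; rewrite num_startE.
by rewrite -(mem_imset _ _ inj) -[X in _ || X](mem_imset _ _ inj) !Kg.
Qed.

Lemma num_improvable k :
  improvable num_graph num_start k <-> improvable (subdiv2 H) (start H L) k.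
Proof.
rewrite num_startE; symmetry; apply: improvable_isoE vnum_bij _ => u v.
exact: num_adjE.
Qed.

End Coding.

(* [K ^_ r] left vertices have only [K ^_ r - 1] neighbours in the improving
   swaps; each left vertex has degree [r + (K ^_ r - K - 1)]. *)
Definition budget (r K : nat) : nat :=
  2 * (K ^_ r) * (r + (K ^_ r - K - 1)) + 2 * (K ^_ r) - 1.

Definition instance_bits (nw r K : nat) (L : seq (seq nat)) : seq bool :=
  graph_bits (subdiv_codes (size L + (nw + (K ^_ r - K - 1)))
    (fun x y => link nw L x y || link nw L y x)) (size L).

Section Instance.

Variables (nw r K : nat) (L : seq (seq nat)).
Hypothesis r_gt1 : 1 < r.
Hypothesis rK : r < K.
Hypothesis L_uniq : uniq L.
Hypothesis L_tuple :
  forall t, t \in L -> [/\ size t = r, uniq t & all (fun w => w < nw) t].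

Let np := K ^_ r - K - 1.
Let e (x y : nat) : bool := link nw L x y || link nw L y x.
Let HE (x y : 'I_(size L + (nw + np))) : adj (incidence nw np L) x y = e x y :=
  erefl.
Local Notation S0 := (num_start (size L + (nw + np)) (size L) e).

Lemma instance_ok k :
  is_instance (LS_vertex_cover two_subdivided) (instance_bits nw r K L) k.
Proof.
exists _, (num_graph HE), S0; split.
- exact: graph_bitsE.
- exact: num_two_subdivided.
- by apply: num_start_cover => x y xy; apply: (inc_bip xy).
Qed.

Lemma instance_yes :
  is_yes (LS_vertex_cover two_subdivided) (instance_bits nw r K L) (budget r K)
  <-> exists2 Q : {set 'I_nw}, #|Q| = K & hyperclique r L Q.
Proof.
have q0 : 0 < K ^_ r by rewrite ffact_gt0; lia.
(* The hypothesis [q <= 2 * D] of the swap lemmas. It amounts to [2 * (K + 1 - r) <= K ^_ r], for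
   which the lower bound [K * K.-1] is large enough. *)
have qD : K ^_ r <= 2 * (r + np).
  have := @leq_ffact2 r K ltac:(lia); rewrite /np.
  by move: (K ^_ r) => q; nia.
have deg := inc_deg r_gt1 rK (erefl np) L_uniq L_tuple.
have bip := inc_bip (nw := nw) (np := np) (L := L).
transitivity (improvable (num_graph HE) S0 (budget r K)).
  split=> [[n [G [S [E imp]]]]|imp].
    by apply: code_graph_set_inj imp; rewrite -E; apply: graph_bitsE.
  by exists _, (num_graph HE), S0; split=> //;
    apply: graph_bitsE.
rewrite num_improvable; split.
  move=> [S [cov hd hlt]].
  have [T [TL Tq hT]] := swap_sound bip deg q0 qD cov hd hlt.
  exact: (hall_sound r_gt1 rK erefl L_uniq L_tuple TL Tq hT).
move=> [Q QK hQ].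
have [T [TL Tq hT]] := hall_complete r_gt1 rK erefl L_uniq QK hQ.
by have [S [cov hd hlt]] := swap_complete bip deg q0 qD TL Tq hT; exists S.
Qed.

End Instance.

(** * Partial evaluation of circuits *)

Section CircuitFold.

Variables (T : Type) (step : seq T -> gate -> T).

Lemma circuit_fold_rcons c g : circuit_fold step (rcons c g) =
  rcons (circuit_fold step c) (step (circuit_fold step c) g).
Proof. by rewrite /circuit_fold foldl_rcons. Qed.

Lemma size_circuit_fold c : size (circuit_fold step c) = size c.
Proof.
by elim/last_ind: c => // c g IH; rewrite circuit_fold_rcons !size_rcons IH.
Qed.

Lemma nth_circuit_fold x0 c j : j < size c -> nth x0 (circuit_fold step c) j =
  step (take j (circuit_fold step c)) (nth Input c j).
Proof.
elim/last_ind: c => // c g IH; rewrite size_rcons ltnS leq_eqVlt.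
rewrite circuit_fold_rcons !nth_rcons size_circuit_fold.
case/orP=> [/eqP ->|lt].
  by rewrite ltnn eqxx -cats1 take_size_cat ?size_circuit_fold.
by rewrite lt IH // -cats1 takel_cat // size_circuit_fold ltnW.
Qed.

End CircuitFold.

(** Gates as plain data for the programs: a tag and an argument list, both of types with an [Enc]
    instance. *)
Definition pgate : Type := (nat * seq nat)%type.

Definition gcode (g : gate) : pgate :=
  match g with
  | Input => (0, [::])
  | Not i => (1, [:: i])
  | And s => (2, s)
  | Or s => (3, s)
  end.

Notation unknown := (false, false).

(* Kleene's three-valued logic: the components of a value say whether it is
   known to be true and known to be false. *)
Definition kgate (vs : seq (bool * bool)) (g : pgate) : bool * bool :=
  if g.1 == 0 then unknown else
  if g.1 == 1 then ((nth unknown vs (nth 0 g.2 0)).2, (nth unknown vs (nth 0 g.2 0)).1) else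
  if g.1 == 2 then (all (fun i => (nth unknown vs i).1) g.2,
                    has (fun i => (nth unknown vs i).2) g.2)
  else (has (fun i => (nth unknown vs i).1) g.2,
        all (fun i => (nth unknown vs i).2) g.2).

(** [os] supplies assumptions at arbitrary nodes, on top of what the arguments yield. The two bits
    of a value are independent and may both hold, so the assumptions need not be consistent. *)
Definition kstep (os vs : seq (bool * bool)) (g : pgate) : bool * bool :=
  ((nth unknown os (size vs)).1 || (kgate vs g).1,
   (nth unknown os (size vs)).2 || (kgate vs g).2).

Definition keval (os : seq (bool * bool)) (pc : seq pgate) : seq (bool * bool) :=
  foldl (fun vs g => rcons vs (kstep os vs g)) [::] pc.

Definition known (v : bool * bool) (b : bool) : bool := if b then v.1 else v.2.

Lemma keval_fold os c :
  keval os (map gcode c) = circuit_fold (fun vs g => kstep os vs (gcode g)) c.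
Proof.
elim/last_ind: c => // c g IH.
by rewrite map_rcons /keval foldl_rcons circuit_fold_rcons -/(keval os _) IH.
Qed.

Arguments known : simpl never.

(* A literal on a large gate is admitted only if its negation would have a
   witness among the arguments. *)
Definition lit_ok (g : pgate) (b : bool) : bool :=
  (g.1 == 0) || (2 < size g.2) && ((g.1 == 2) && b || (g.1 == 3) && ~~ b).

Section Circuit.

Variable c : circuit.
Hypothesis wf : circuit_wf c.

Local Notation G := (nth Input c).
Local Notation N := (size c).

Definition args (j : nat) : seq nat := (gcode (G j)).2.

Lemma args_lt j i : j < N -> i \in args j -> i < j.
Proof.
move=> jN; have : gate_wf j (G j).
  by case/andP: wf => _ /allP; apply; rewrite mem_iota.
rewrite /args; case: (G j) => //= [k|s|s].
- by rewrite inE => lt /eqP ->.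
- by case/and3P=> _ _ /allP; apply.
- by case/and3P=> _ _ /allP; apply.
Qed.

Lemma size_args j : j < N -> match G j with And s | Or s => 1 < size s | _ => True end.
Proof.
move=> jN; have : gate_wf j (G j).
  by case/andP: wf => _ /allP; apply; rewrite mem_iota.
by case: (G j) => //= s /and3P[].
Qed.

Definition val_at (X : pred nat) (j : nat) : bool :=
  nth false (circuit_fold (gate_val X) c) j.
Definition weft_at (j : nat) : nat := nth 0 (circuit_fold gate_weft c) j.
Definition depth_at (j : nat) : nat := nth 0 (circuit_fold gate_depth c) j.
Definition kval (os : seq (bool * bool)) (j : nat) : bool * bool :=
  nth unknown (keval os (map gcode c)) j.

Lemma val_atE X j : j < N -> val_at X j =
  match G j with
  | Input => X j
  | Not i => ~~ val_at X i
  | And s => all (val_at X) s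
  | Or s => has (val_at X) s
  end.
Proof.
move=> jN; rewrite /val_at nth_circuit_fold //.
have := @args_lt j ^~ jN; rewrite /args; case: (G j) => //= [|i|s|s] h.
- by rewrite size_takel // size_circuit_fold ltnW.
- by rewrite nth_take // h ?inE.
- by apply: eq_in_all => i /h lt; rewrite nth_take.
- by apply: eq_in_has => i /h lt; rewrite nth_take.
Qed.

Lemma weft_atE j : j < N -> weft_at j =
  match G j with
  | Input => 0
  | Not i => weft_at i
  | And s | Or s => (2 < size s) + \max_(i <- s) weft_at i
  end.
Proof.
move=> jN; rewrite /weft_at nth_circuit_fold //.
have := @args_lt j ^~ jN; rewrite /args; case: (G j) => //= [i|s|s] h.
- by rewrite nth_take // h ?inE.
- by congr (_ + _); apply: eq_big_seq => i /h lt; rewrite nth_take.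
- by congr (_ + _); apply: eq_big_seq => i /h lt; rewrite nth_take.
Qed.

Lemma depth_atE j : j < N -> depth_at j =
  match G j with
  | Input => 0
  | Not i => (depth_at i).+1
  | And s | Or s => (\max_(i <- s) depth_at i).+1
  end.
Proof.
move=> jN; rewrite /depth_at nth_circuit_fold //.
have := @args_lt j ^~ jN; rewrite /args; case: (G j) => //= [i|s|s] h.
- by rewrite nth_take // h ?inE.
- by congr _.+1; apply: eq_big_seq => i /h lt; rewrite nth_take.
- by congr _.+1; apply: eq_big_seq => i /h lt; rewrite nth_take.
Qed.

Lemma knownE os j b : j < N -> known (kval os j) b =
  known (nth unknown os j) b ||
  match G j with
  | Input => false
  | Not i => known (kval os i) (~~ b)
  | And s => if b then all (fun i => known (kval os i) true) s
             else has (fun i => known (kval os i) false) s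
  | Or s => if b then has (fun i => known (kval os i) true) s
            else all (fun i => known (kval os i) false) s
  end.
Proof.
move=> jN; rewrite /kval keval_fold nth_circuit_fold //.
rewrite /kstep size_takel ?size_circuit_fold; last exact: ltnW.
have := @args_lt j ^~ jN; rewrite /args; case: (G j) => //= [|i|s|s] h.
- by case: b.
- by rewrite /kgate /= nth_take ?h ?inE //; case: b.
- case: b => /=; rewrite /kgate /=; congr (_ || _).
    by apply: eq_in_all => i /h lt; rewrite nth_take.
  by apply: eq_in_has => i /h lt; rewrite nth_take.
- case: b => /=; rewrite /kgate /=; congr (_ || _).
    by apply: eq_in_has => i /h lt; rewrite nth_take.
  by apply: eq_in_all => i /h lt; rewrite nth_take.
Qed.

Lemma weft_arg j i : j < N -> i \in args j -> weft_at i <= weft_at j.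
Proof.
move=> jN; rewrite (weft_atE jN) /args; case: (G j) => //= [k|s|s].
- by rewrite inE => /eqP ->.
- by move=> h; apply: leq_trans (leq_addl _ _); apply: leq_bigmax_seq.
- by move=> h; apply: leq_trans (leq_addl _ _); apply: leq_bigmax_seq.
Qed.

Lemma weft_arg_large j i : j < N -> i \in args j -> 2 < size (args j) ->
  weft_at i < weft_at j.
Proof.
move=> jN; rewrite (weft_atE jN) /args; case: (G j) => //= [s|s] h ->.
- by rewrite add1n ltnS; apply: leq_bigmax_seq.
- by rewrite add1n ltnS; apply: leq_bigmax_seq.
Qed.

Lemma depth_arg j i : j < N -> i \in args j -> depth_at i < depth_at j.
Proof.
move=> jN; rewrite (depth_atE jN) /args; case: (G j) => //= [k|s|s].
- by rewrite inE => /eqP ->.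
- by move=> h; rewrite ltnS; apply: leq_bigmax_seq.
- by move=> h; rewrite ltnS; apply: leq_bigmax_seq.
Qed.

(** The set [P] is closed under arguments, so assumptions have to be right only there. This matters
    for claimed literals: they are verified only at nodes of weft at most 1 and depth at most [d],
    and nodes that do not feed the output may violate these bounds. *)
Lemma known_sound X os (P : pred nat) :
  (forall j i, j < N -> i \in args j -> P j -> P i) ->
  (forall j b, j < N -> P j -> known (nth unknown os j) b -> val_at X j = b) ->
  forall j b, j < N -> P j -> known (kval os j) b -> val_at X j = b.
Proof.
move=> hP hos; elim/ltn_ind => j IH b jN Pj; rewrite knownE //.
case/orP=> [|h]; first exact: hos.
have arg i b' : i \in args j -> known (kval os i) b' -> val_at X i = b'.
  by move=> ij; apply: IH (hP _ _ jN ij Pj); have := args_lt jN ij; lia.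
rewrite val_atE //; move: arg h; rewrite /args; case: (G j) => //= [i|s|s] arg.
- by move=> /arg -> //; rewrite ?inE ?negbK.
- case: b => [/allP h|/hasP[i si h]].
    by apply/allP => i si; apply: arg => //; apply: h.
  by apply/negbTE/allPn; exists i => //; rewrite (arg _ _ si h).
- case: b => [/hasP[i si h]|/allP h].
    by apply/hasP; exists i => //; apply: arg.
  by apply/hasPn => i si; rewrite (arg _ _ si (h i si)).
Qed.

(** Nonemptiness allows padding to an exact length by repeating a literal. The clause for weft 0
    makes claims about large gates refutable: an argument of such a gate is forced by inputs
    alone. *)
Definition certifies X j (cl : seq (nat * bool)) (b : nat) : Prop :=
  [/\ 0 < size cl <= b,
    forall l, l \in cl ->
      [/\ l.1 < N, val_at X l.1 = l.2 & lit_ok (gcode (G l.1)) l.2],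
    weft_at j = 0 -> forall l, l \in cl -> G l.1 = Input &
    forall os, (forall l, l \in cl -> known (nth unknown os l.1) l.2) ->
      known (kval os j) (val_at X j)].

(* Unfold the reasons for the value of j; stop at the inputs and at the large
   gates whose value is due to all of their arguments. *)
Lemma certificate X e j : j < N -> weft_at j <= 1 -> depth_at j <= e ->
  exists cl, certifies X j cl (2 ^ e).
Proof.
have gt0 n : 0 < 2 ^ n by rewrite expn_gt0.
elim: e j => [|e IH] j jN wj dj.
  have Gj : G j = Input.
    by move: dj; rewrite depth_atE //; case: (G j).
  exists [:: (j, val_at X j)]; split=> //.
  - by move=> l; rewrite inE => /eqP -> /=; rewrite /lit_ok Gj.
  - by move=> _ l; rewrite inE => /eqP ->.
  - by move=> os h; rewrite knownE // (h (j, val_at X j)) ?inE.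
(* Three ways to proceed: stop with one literal, follow one argument that decides the gate, or merge
   the certificates of both arguments of a small gate. The last doubles the bound, hence [2 ^ e]. *)
have single : lit_ok (gcode (G j)) (val_at X j) -> (weft_at j = 0 -> G j = Input) ->
  exists cl, certifies X j cl (2 ^ e.+1).
  move=> hl hw; exists [:: (j, val_at X j)]; split=> //.
  - by rewrite /= gt0.
  - by move=> l; rewrite inE => /eqP ->.
  - by move=> /hw Gj l; rewrite inE => /eqP ->.
  - by move=> os h; rewrite knownE // (h (j, val_at X j)) ?inE.
have one i : i \in args j ->
    (forall os, known (kval os i) (val_at X i) -> known (kval os j) (val_at X j)) ->
  exists cl, certifies X j cl (2 ^ e.+1).
  move=> ij hij; have lij := args_lt jN ij.
  have [||| cl [sO hO wO kO]] := IH i; first by lia.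
  - by have := weft_arg jN ij; lia.
  - by have := depth_arg jN ij; lia.
  exists cl; split=> //.
  - by have := gt0 e; rewrite expnS; lia.
  - by move=> w0; apply: wO; have := weft_arg jN ij; lia.
  - by move=> os h; apply: hij; apply: kO.
have two i1 i2 : args j = [:: i1; i2] ->
    (forall os, known (kval os i1) (val_at X i1) -> known (kval os i2) (val_at X i2) ->
      known (kval os j) (val_at X j)) ->
  exists cl, certifies X j cl (2 ^ e.+1).
  move=> aj hij; have ij1 : i1 \in args j by rewrite aj inE eqxx.
  have ij2 : i2 \in args j by rewrite aj !inE eqxx orbT.
  have := args_lt jN ij1; have := args_lt jN ij2 => lij1 lij2.
  have [||| cl1 [sO1 hO1 wO1 kO1]] := IH i1; first by lia.
  - by have := weft_arg jN ij1; lia.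
  - by have := depth_arg jN ij1; lia.
  have [||| cl2 [sO2 hO2 wO2 kO2]] := IH i2; first by lia.
  - by have := weft_arg jN ij2; lia.
  - by have := depth_arg jN ij2; lia.
  exists (cl1 ++ cl2); split=> //.
  - by rewrite size_cat expnS; lia.
  - by move=> l; rewrite mem_cat => /orP[/hO1|/hO2].
  - move=> w0 l; rewrite mem_cat => /orP[]; [apply: wO1 | apply: wO2].
      by have := weft_arg jN ij1; lia.
    by have := weft_arg jN ij2; lia.
  - move=> os h; apply: hij; [apply: kO1 | apply: kO2] => l hl; apply: h.
      by rewrite mem_cat hl.
    by rewrite mem_cat hl orbT.
have vj := val_atE X jN; have wj' := weft_atE jN; have kj os := knownE os (val_at X j) jN.
have sj := size_args jN.
rewrite /args in single one two *; case: (G j) vj wj' kj sj single one two => /=.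
- by move=> _ _ _ _ single _ _; apply: single.
- move=> i vj _ kj _ _ one _; apply: (one i); rewrite ?inE // => os.
  by move=> h; rewrite kj vj negbK h orbT.
- move=> s vj wj' kj sj single one two.
  have [vt|vf] := boolP (val_at X j).
    have [large|small] := ltnP 2 (size s).
      (* A large gate has positive weft, so the clause for weft 0 is vacuous. *)
      by rewrite vt in single; apply: single; rewrite /lit_ok /= ?large //; lia.
    rewrite vt in vj kj two.
    case: s sj small vj wj' kj single one two => [|i1 [|i2 []]] //= _ _ vj _ kj _ _ two.
    apply: (two i1 i2) => // os; rewrite kj; rewrite andbT in vj.
    by case/andP: (esym vj) => -> -> -> ->; rewrite orbT.
  rewrite (negbTE vf) in vj one kj; have /allPn[i si vi] := negbT (esym vj).
  apply: (one i) => // os h; rewrite kj; apply/orP; right; apply/hasP; exists i => //.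
  by rewrite (negbTE vi) in h.
- move=> s vj wj' kj sj single one two.
  have [vt|vf] := boolP (val_at X j).
    rewrite vt in vj one kj; have /hasP[i si vi] := esym vj.
    apply: (one i) => // os h; rewrite kj; apply/orP; right; apply/hasP; exists i => //.
    by rewrite vi in h.
  have [large|small] := ltnP 2 (size s).
    by rewrite (negbTE vf) in single; apply: single; rewrite /lit_ok /= ?large //; lia.
  rewrite (negbTE vf) in vj kj two.
  case: s sj small vj wj' kj single one two => [|i1 [|i2 []]] //= _ _ vj _ kj _ _ two.
  apply: (two i1 i2) => // os; rewrite kj.
  move: (negbT (esym vj)); rewrite orbF negb_or.
  by case/andP=> /negbTE -> /negbTE -> -> ->; rewrite orbT.
Qed.

Lemma eq_circuit_val (X Y : pred nat) : X =1 Y -> circuit_val c X = circuit_val c Y.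
Proof.
move=> XY; congr last; elim/last_ind: (c) => // c' g IH.
by rewrite !circuit_fold_rcons IH; case: g => //=; rewrite XY.
Qed.

Lemma circuit_val_last X : circuit_val c X = val_at X N.-1.
Proof. by rewrite /circuit_val /val_at -nth_last size_circuit_fold. Qed.

Lemma circuit_weft_last : circuit_weft c = weft_at N.-1.
Proof. by rewrite /circuit_weft /weft_at -nth_last size_circuit_fold. Qed.

Lemma circuit_depth_last : circuit_depth c = depth_at N.-1.
Proof. by rewrite /circuit_depth /depth_at -nth_last size_circuit_fold. Qed.

End Circuit.

(** * From circuits to hypercliques *)

Definition lit : Type := (nat * bool)%type.

(* A node (p, (a, cl)): the position p, the value a at this position, and the
   literals claimed there. *)
Definition node : Type := (nat * (nat * seq lit))%type.

Definition node0 : node := (0, (0, [::])).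
Definition pos (u : node) : nat := u.1.
Definition vl (u : node) : nat := u.2.1.
Definition lits (u : node) : seq lit := u.2.2.

Definition input_at (pc : seq pgate) (j : nat) : bool := (nth (0, [::]) pc j).1 == 0.

Definition says_true (t : seq node) (j : nat) : bool :=
  has (fun u => vl u == j.+1) t.

(** The two positions are consecutive, so if values increase with the position, no position at all
    can carry the value [j.+1]. *)
Definition says_false (t : seq node) (j : nat) : bool :=
  has (fun u => has (fun v => (pos v == (pos u).+1) &&
    ((vl u < j.+1) && (j.+1 < vl v))) t) t.

Definition info (pc : seq pgate) (t : seq node) : seq (bool * bool) :=
  [seq (input_at pc j && says_true t j, input_at pc j && says_false t j)
     | j <- iota 0 (size pc)].

(** The test rejects only on evidence: a tuple that knows too little to refute a literal passes. So
    true claims survive in every tuple, while a false claim needs just one tuple that contains its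
    refutation. *)
Definition lits_ok (pc : seq pgate) (t : seq node) : bool :=
  all (fun u => all (fun l =>
    ~~ known (nth unknown (keval (info pc t) pc) l.1) (~~ l.2)) (lits u)) t.

Definition uniqb (s : seq nat) : bool :=
  all (fun x => size [seq y <- s | y == x] == 1) s.

Definition tuple_ok (pc : seq pgate) (t : seq node) : bool :=
  (uniqb [seq pos u | u <- t] &&
   all (fun u => all (fun v => ~~ (pos u < pos v) || (vl u < vl v)) t) t) &&
  lits_ok pc t.

Definition assume (pc : seq pgate) (cl : seq lit) : seq (bool * bool) :=
  [seq (has (fun l => (l.1 == j) && l.2) cl, has (fun l => (l.1 == j) && ~~ l.2) cl)
     | j <- iota 0 (size pc)].

Definition good_lits (pc : seq pgate) (cl : seq lit) : bool :=
  all (fun l => lit_ok (nth (0, [::]) pc l.1) l.2) cl &&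
  (nth unknown (keval (assume pc cl) pc) (size pc).-1).1.

Fixpoint lists (T : Type) (m : nat) (s : seq T) : seq (seq T) :=
  if m is m'.+1 then [seq x :: t | x <- s, t <- lists m' s] else [:: [::]].

Definition literals (n : nat) : seq lit :=
  [seq (j, b) | j <- iota 0 n, b <- [:: true; false]].

(* Position 0 and the r + 1 positions after the k-th carry sentinels; the
   positions 1, ..., k carry the input gates set to true, in increasing order
   and numbered from 1; the last position carries the certificate. *)
Definition nodes (m r : nat) (pc : seq pgate) (k : nat) : seq node :=
  node0 ::
  ([seq (i.+1, (v.+1, [::])) | i <- iota 0 k,
     v <- [seq v <- iota 0 (size pc) | input_at pc v]] ++
  ([seq (k.+1 + p, ((size pc).+1 + (k.+1 + p), [::])) | p <- iota 0 r.+1] ++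
   [seq (k.+1 + r.+1, ((size pc).+1 + (k.+1 + r.+1), cl))
      | cl <- [seq cl <- lists m (literals (size pc)) | good_lits pc cl]])).

(** Tuples of indices rather than of nodes, since nodes become numbered vertices of the bipartite
    graph. *)
Definition tuples (m r : nat) (pc : seq pgate) (k : nat) : seq (seq nat) :=
  [seq t <- lists r (iota 0 (size (nodes m r pc k)))
     | tuple_ok pc [seq nth node0 (nodes m r pc k) i | i <- t]].

Lemma uniqbE s : uniqb s = uniq s.
Proof.
apply/allP/idP => [h|un x xs].
  apply: count_mem_uniq => x; have [xs|xs] := boolP (x \in s).
    by have /eqP := h x xs; rewrite size_filter.
  exact/count_memPn.
by rewrite size_filter; have := count_uniq_mem x un; rewrite xs => ->.
Qed.

Lemma mem_lists (T : eqType) m (s t : seq T) :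
  (t \in lists m s) = (size t == m) && all (mem s) t.
Proof.
elim: m t => [|m IH] t /=; first by rewrite inE; case: t.
apply/allpairsP/idP => [[[x u] /= [xs]]|].
  by rewrite IH => /andP[/eqP <- h] -> /=; rewrite eqxx xs.
case: t => //= x u; rewrite eqSS => /andP[sz /andP[xs us]].
by exists (x, u); rewrite IH sz us.
Qed.

Lemma lists_uniq (T : eqType) m (s : seq T) : uniq s -> uniq (lists m s).
Proof.
move=> un; elim: m => // m IH /=; apply: allpairs_uniq => //.
by move=> [x t] [y u] _ _ [-> ->].
Qed.

Lemma tuples_uniq m r pc k : uniq (tuples m r pc k).
Proof. by apply/filter_uniq/lists_uniq/iota_uniq. Qed.

Lemma tuplesP m r pc k t : t \in tuples m r pc k ->
  [/\ size t = r, uniq t & all (fun i => i < size (nodes m r pc k)) t].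
Proof.
rewrite mem_filter mem_lists => /andP[/andP[/andP[h _] _] /andP[/eqP -> lt]].
split=> //; first by move: h; rewrite uniqbE => /map_uniq/map_uniq.
apply: sub_all lt => i hi.
have : i \in iota 0 (size (nodes m r pc k)) by exact: hi.
by rewrite mem_iota.
Qed.

Lemma mem_literals n l : (l \in literals n) = (l.1 < n).
Proof.
apply/allpairsP/idP => [[[j b] /= [jn _ ->]]|ln]; first by rewrite mem_iota in jn.
by case: l ln => j b jn; exists (j, b); rewrite mem_iota; split=> //; case: b {jn}.
Qed.

Lemma mem_nodes m r pc k (u : node) : u \in nodes m r pc k ->
  [\/ u = node0,
      exists i v, [/\ i < k, v < size pc, input_at pc v & u = (i.+1, (v.+1, [::]))],
      exists2 p, p < r.+1 & u = (k.+1 + p, ((size pc).+1 + (k.+1 + p), [::])) |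
      exists cl, [/\ cl \in lists m (literals (size pc)), good_lits pc cl &
        u = (k.+1 + r.+1, ((size pc).+1 + (k.+1 + r.+1), cl))]].
Proof.
rewrite inE !mem_cat => /or4P[/eqP->|/allpairsP[[i v] /= [ik vh ->]]
  |/mapP[p pr ->]|/mapP[cl Oh ->]].
- by constructor 1.
- constructor 2; exists i, v; move: ik vh.
  by rewrite mem_filter !mem_iota => ik /andP[].
- by constructor 3; exists p => //; rewrite mem_iota in pr.
- by constructor 4; exists cl; move: Oh; rewrite mem_filter => /andP[].
Qed.

Section Hyperclique.

Variables (c : circuit) (d k : nat).
Hypothesis wf : circuit_wf c.
Hypothesis weft_c : circuit_weft c <= 1.
Hypothesis depth_c : circuit_depth c <= d.

Local Notation G := (nth Input c).
Local Notation N := (size c).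

Let m := 2 ^ d.
Let r := (2 * m).+1.
(** The number of positions: 0 to [k], then [r + 1] sentinels, then the position of the
    certificate. *)
Let K := k.+1 + r.+1.+1.
Let pc := map gcode c.
Let ns := nodes m r pc k.
Let L := tuples m r pc k.

Lemma pcE j : nth (0, [::]) pc j = gcode (G j).
Proof.
have [jN|jN] := ltnP j N; first by rewrite (nth_map Input).
by rewrite !nth_default ?size_map.
Qed.

Lemma input_atE j : input_at pc j = is_input (G j).
Proof. by rewrite /input_at pcE; case: (G j). Qed.

Lemma known_info t j b : j < N -> known (nth unknown (info pc t) j) b =
  is_input (G j) && (if b then says_true t j else says_false t j).
Proof.
move=> jN; rewrite (nth_map 0) ?size_iota ?size_map // nth_iota ?size_map //.
by rewrite add0n input_atE; case: b.
Qed.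

Lemma known_assume cl j b : j < N ->
  known (nth unknown (assume pc cl) j) b = ((j, b) \in cl).
Proof.
move=> jN; rewrite (nth_map 0) ?size_iota ?size_map // nth_iota ?size_map //.
rewrite add0n; case: b => /=; apply/hasP/idP.
- by move=> [[i b] iO /= /andP[/eqP <-]]; case: b iO.
- by move=> jO; exists (j, true); rewrite //= eqxx.
- by move=> [[i b] iO /= /andP[/eqP <-]]; case: b iO.
- by move=> jO; exists (j, false); rewrite //= eqxx.
Qed.

Lemma m_gt0 : 0 < m. Proof. by rewrite expn_gt0. Qed.

Lemma N_gt0 : 0 < N. Proof. by case/andP: wf. Qed.

(** * From a hyperclique to a satisfying set of inputs *)

Section Sound.

Variable Q : {set 'I_(size ns)}.
Hypothesis cardQ : #|Q| = K.
Hypothesis QL : hyperclique r L Q.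

Let nd (i : 'I_(size ns)) : node := nth node0 ns i.

(** Only full [r]-tuples are tested, but [r <= K] lets any few members of [Q] be completed to one
    inside [Q]. Hence every consequence of the test that involves at most [r] nodes holds throughout
    [Q]. *)
Lemma sound_indices (us : seq 'I_(size ns)) : {subset us <= Q} -> size us <= r ->
  exists ts, [/\ uniq ts, {subset us <= ts} & tuple_ok pc [seq nd i | i <- ts]].
Proof.
move=> usQ szu.
pose v := undup us ++ [seq i <- enum Q | i \notin us].
have vU : uniq v.
  rewrite cat_uniq undup_uniq filter_uniq ?enum_uniq // andbT.
  by apply/hasPn => i; rewrite mem_filter mem_undup => /andP[].
have vQ : v =i Q.
  move=> i; rewrite mem_cat mem_undup mem_filter mem_enum.
  by have [/usQ ->|] := boolP (i \in us).
have szv : size v = K by rewrite -cardQ -(card_uniqP vU); apply: eq_card.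
have szt : size (take r v) == r by rewrite size_takel // szv /K; lia.
exists (take r v); rewrite take_uniq //; split=> //.
  move=> i iu; have le : size (undup us) <= r.
    by apply: leq_trans szu; apply: size_undup.
  by rewrite take_cat ltnNge le /= mem_cat mem_undup iu.
have tQ : all (mem Q) (take r v) by apply/allP => i /mem_take; rewrite vQ.
have := QL (t := Tuple szt) (take_uniq _ vU) tQ.
by rewrite mem_filter => /andP[tok _]; move: tok; rewrite -map_comp.
Qed.

Lemma sound_tuple (us : seq 'I_(size ns)) : {subset us <= Q} -> size us <= r ->
  exists t : seq node, {subset [seq nd i | i <- us] <= t} /\ tuple_ok pc t.
Proof.
move=> usQ /(sound_indices usQ)[ts [_ sub tok]].
by exists [seq nd i | i <- ts]; split=> // u /mapP[i /sub its ->]; apply: map_f.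
Qed.

Lemma sound_pos_inj : {in Q &, injective (fun i => pos (nd i))}.
Proof.
move=> i j iQ jQ eqij.
have [||ts [_ sub /andP[/andP[un _] _]]] := sound_indices (us := [:: i; j]).
- by move=> x; rewrite !inE => /orP[]/eqP ->.
- by have := m_gt0; rewrite /r /=; lia.
have it : i \in ts by apply: sub; rewrite inE eqxx.
have jt : j \in ts by apply: sub; rewrite !inE eqxx orbT.
rewrite uniqbE -map_comp in un.
have := @nth_uniq _ 0 [seq (pos \o nd) x | x <- ts] (index i ts) (index j ts).
rewrite size_map !index_mem !(nth_map i) ?index_mem // !nth_index //=.
rewrite eqij eqxx => /(_ it jt un) /esym/eqP/(congr1 (nth i ts)).
by rewrite !nth_index.
Qed.

Lemma pos_lt (i : 'I_(size ns)) : pos (nd i) < K.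
Proof.
have := mem_nth node0 (ltn_ord i); rewrite /nd /K.
by case/mem_nodes => [->|[j [v [? ? _ ->]]]|[p ? ->]|[cl [_ _ ->]]]; rewrite /pos /=; lia.
Qed.

(** Pigeonhole: [K] nodes with distinct positions below [K] occupy all of them. *)
Lemma sound_at p : p < K -> exists2 i, i \in Q & pos (nd i) = p.
Proof.
move=> pK; pose f (i : 'I_(size ns)) : 'I_K := Ordinal (pos_lt i).
have inj : {in Q &, injective f}.
  by move=> i j iQ jQ [] ; apply: sound_pos_inj.
have : f @: Q = setT.
  by apply/eqP; rewrite eqEcard subsetT cardsT card_ord card_in_imset // cardQ /=.
move=> /setP/(_ (Ordinal pK)); rewrite inE => /imsetP[i iQ /(congr1 val) /= ->].
by exists i.
Qed.

Definition at_pos (p : nat) : node :=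
  if [pick i in Q | pos (nd i) == p] is Some i then nd i else node0.

Lemma at_posP p : p < K -> exists i, [/\ i \in Q, nd i = at_pos p & pos (nd i) = p].
Proof.
move=> pK; rewrite /at_pos; case: pickP => [i /andP[iQ /eqP ip]|h].
  by exists i.
by have [i iQ ip] := sound_at pK; have := h i; rewrite iQ ip eqxx.
Qed.

Lemma pos_at p : p < K -> pos (at_pos p) = p.
Proof. by case/at_posP => i [_ <-]. Qed.

Lemma at_pos_mem p : p < K -> at_pos p \in ns.
Proof. by case/at_posP => i [_ <- _]; apply: mem_nth. Qed.

Lemma at_tuple (ps : seq nat) : all (fun p => p < K) ps -> size ps <= r ->
  exists t, {subset [seq at_pos p | p <- ps] <= t} /\ tuple_ok pc t.
Proof.
move=> /allP h sz; have : exists us, [/\ {subset us <= Q}, size us = size ps &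
    [seq nd i | i <- us] = [seq at_pos p | p <- ps]].
  elim: ps h {sz} => [|p ps IH] h; first by exists [::].
  have [i [iQ iE _]] := at_posP (h p (mem_head _ _)).
  have [|us [usQ szu usE]] := IH.
    by move=> q qps; apply: h; rewrite inE qps orbT.
  exists (i :: us); rewrite /= szu iE usE; split=> //.
  by move=> x; rewrite inE => /orP[/eqP->|/usQ].
move=> [us [usQ szu <-]]; apply: sound_tuple => //; rewrite szu //.
Qed.

Lemma vl_mono p q : p < q -> q < K -> vl (at_pos p) < vl (at_pos q).
Proof.
move=> pq qK; have pK : p < K := ltn_trans pq qK.
have [||t [sub /andP[/andP[_ /allP h] _]]] := at_tuple (ps := [:: p; q]).
- by rewrite /= pK qK.
- by have := m_gt0; rewrite /r /=; lia.
have := h (at_pos p); rewrite sub ?inE ?eqxx // => /(_ isT) /allP/(_ (at_pos q)).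
rewrite sub ?inE ?eqxx ?orbT // => /(_ isT).
by rewrite !pos_at // pq.
Qed.

Lemma at0 : vl (at_pos 0) = 0.
Proof.
have := at_pos_mem (p := 0) isT; have := pos_at (p := 0) isT.
by move=> h /mem_nodes[e|[j [v [? ? _ e]]]|[p ? e]|[cl [_ _ e]]]; move: h; rewrite e.
Qed.

Lemma at_mid i : i < k -> exists v,
  [/\ v < N, is_input (G v) & at_pos i.+1 = (i.+1, (v.+1, [::]))].
Proof.
move=> ik; have iK : i.+1 < K by rewrite /K; lia.
have := at_pos_mem iK; have := pos_at iK.
move=> h /mem_nodes[e|[j [v [? vN vi e]]]|[p ? e]|[cl [_ _ e]]]; move: h;
  rewrite e /pos /=; try lia.
by move=> [->]; exists v; rewrite -input_atE vi; rewrite size_map in vN.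
Qed.

Lemma at_end p : p < r.+1 -> vl (at_pos (k.+1 + p)) = N.+1 + (k.+1 + p).
Proof.
move=> pr; have pK : k.+1 + p < K by rewrite /K; lia.
have := at_pos_mem pK; have := pos_at pK.
move=> h /mem_nodes[e|[j [v [? vN vi e]]]|[q ? e]|[cl [_ _ e]]]; move: h;
  rewrite e /pos /vl /=; try lia.
by move=> ->; rewrite size_map.
Qed.

Lemma at_last : exists cl, [/\ cl \in lists m (literals N), good_lits pc cl &
  lits (at_pos (k.+1 + r.+1)) = cl].
Proof.
have pK : k.+1 + r.+1 < K by rewrite /K; lia.
have := at_pos_mem pK; have := pos_at pK.
move=> h /mem_nodes[e|[j [v [? vN vi e]]]|[q ? e]|[cl [h1 h2 e]]]; move: h;
  rewrite e /pos /vl /=; try lia.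
by move=> _; exists cl; rewrite size_map in h1.
Qed.

Definition sol (j : nat) : bool := j.+1 \in [seq vl (at_pos i.+1) | i <- iota 0 k].

(** A chosen input shows at one position. For any other, take the last position up to [k] with a
    value below [v.+1], which exists because position 0 carries 0; the next position, possibly the
    first sentinel on the right, has a value above. *)
Lemma sol_cert v : v < N -> is_input (G v) -> exists ps : seq nat,
  [/\ all (fun p => p < K) ps, size ps <= 2 &
      forall t, {subset [seq at_pos p | p <- ps] <= t} ->
        known (nth unknown (info pc t) v) (sol v)].
Proof.
move=> vN vi; have [h|h] := boolP (sol v).
  have /mapP[i] := h; rewrite mem_iota /= add0n => ik iE.
  exists [:: i.+1]; split=> //.
    by rewrite /= andbT /K; lia.
  move=> t sub; rewrite known_info // vi; apply/hasP; exists (at_pos i.+1).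
    by apply: sub; rewrite inE.
  by rewrite -iE.
have ex0 : exists p, (p <= k) && (vl (at_pos p) < v.+1).
  by exists 0; rewrite at0.
have ub p : (p <= k) && (vl (at_pos p) < v.+1) -> p <= k by case/andP.
case: (ex_maxnP ex0 ub) => p /andP[pk lt] pmax.
exists [:: p; p.+1]; split=> //.
  by rewrite /= /K andbT; lia.
move=> t sub; rewrite known_info // vi; apply/hasP; exists (at_pos p).
  by apply: sub; rewrite inE eqxx.
apply/hasP; exists (at_pos p.+1); first by apply: sub; rewrite !inE eqxx orbT.
rewrite !pos_at ?eqxx ?lt /=; [|rewrite /K; lia..].
have [pk1|pk1] := ltnP p k.
  rewrite ltn_neqAle; apply/andP; split.
    by apply: contra h => /eqP e; rewrite /sol e; apply: map_f; rewrite mem_iota.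
  rewrite leqNgt; apply/negP => lt1; have := pmax p.+1.
  by rewrite pk1 lt1 => /(_ isT); rewrite ltnn.
have -> : p.+1 = k.+1 + 0 by lia.
by rewrite at_end //; lia.
Qed.

Lemma sol_certs (vs : seq nat) : all (fun v => v < N) vs ->
  all (fun v => is_input (G v)) vs -> exists ps : seq nat,
  [/\ all (fun p => p < K) ps, size ps <= 2 * size vs &
      forall t, {subset [seq at_pos p | p <- ps] <= t} ->
        forall v, v \in vs -> known (nth unknown (info pc t) v) (sol v)].
Proof.
elim: vs => [|v vs IH] /=; first by exists [::].
move=> /andP[vN vsN] /andP[vi vsi].
have [ps [psK sz h]] := sol_cert vN vi; have [qs [qsK sz' h']] := IH vsN vsi.
exists (ps ++ qs); split; first by rewrite all_cat psK.
  by rewrite size_cat; lia.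
move=> t sub w; rewrite inE => /orP[/eqP->|wv].
  by apply: h => u uin; apply: sub; rewrite map_cat mem_cat uin.
by apply: h' w wv => u uin; apply: sub; rewrite map_cat mem_cat uin orbT.
Qed.

(* A refutation of a claimed literal would be visible in a tuple. *)
Lemma lits_true cl : lits (at_pos (k.+1 + r.+1)) = cl -> good_lits pc cl ->
  forall j b, j < N -> weft_at c j <= 1 -> depth_at c j <= d -> (j, b) \in cl ->
  val_at c sol j = b.
Proof.
move=> OE /andP[/allP hO _] j b jN wj dj jO.
apply/eqP; apply/negPn/negP => /eqP neq.
have vj : val_at c sol j = ~~ b by case: (val_at _ _ _) b neq {jO} => -[].
suff [ps [psK szp hps]] : exists ps : seq nat,
  [/\ all (fun p => p < K) ps, size ps <= 2 * m &
      forall t, {subset [seq at_pos p | p <- ps] <= t} ->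
        known (kval c (info pc t) j) (~~ b)].
  (* [r = 2 * m + 1] is exactly the room for a refutation together with the node carrying the
     claim. *)
  have [||t [sub tok]] := at_tuple (ps := k.+1 + r.+1 :: ps).
  - by rewrite /= psK andbT /K; lia.
  - by rewrite /= /r ltnS.
  have := hps t; rewrite /kval -/pc => h.
  case/andP: tok => _ /allP/(_ (at_pos (k.+1 + r.+1))).
  rewrite sub ?inE ?eqxx // => /(_ isT) /allP/(_ (j, b)).
  rewrite OE jO => /(_ isT) /negP; apply; apply: h => u uin.
  by apply: sub; rewrite inE uin orbT.
have m0 := m_gt0.
(* Here [i] is the guilty argument of a large gate. Having weft 0, it is forced by at most [m]
   inputs, each certified by at most two positions. *)
have arm i : i \in args c j -> weft_at c i = 0 ->
    (forall os, known (kval c os i) (val_at c sol i) -> known (kval c os j) (~~ b)) ->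
  exists ps : seq nat,
  [/\ all (fun p => p < K) ps, size ps <= 2 * m &
      forall t, {subset [seq at_pos p | p <- ps] <= t} ->
        known (kval c (info pc t) j) (~~ b)].
  move=> ij w0 hij.
  have [|||cl' [/andP[_ sO'] hO' wO' kO']] := certificate wf sol (e := d) (j := i).
  - by have := args_lt wf jN ij; lia.
  - by rewrite w0.
  - by have := depth_arg wf jN ij; lia.
  have [||ps [psK szp hps]] := sol_certs (vs := [seq l.1 | l <- cl']).
  - by apply/allP => _ /mapP[l /hO'[? _ _] ->].
  - by apply/allP => _ /mapP[l lO' ->]; rewrite (wO' w0 l lO').
  exists ps; split=> //; first by move: szp; rewrite size_map; nia.
  move=> t sub; apply: hij; apply: kO' => l lO'.
  have [l1 <- _] := hO' l lO'; have := hps t sub l.1 (map_f _ lO').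
  by rewrite val_atE // (wO' w0 l lO').
have := hO _ jO; rewrite pcE /= /lit_ok.
case/orP=> [gj|].
  have Gj : G j = Input by case: (G j) gj.
  have [ps [psK szp hps]] := sol_cert jN (v := j) ltac:(by rewrite Gj).
  exists ps; split=> //; first lia.
  move=> t sub; rewrite knownE //; apply/orP; left; rewrite -vj val_atE // Gj.
  exact: hps.
case/andP=> large /orP[|] /andP[gj hb].
  have [s Gj] : exists s, G j = And s by case: (G j) gj => // s; exists s.
  rewrite hb val_atE // Gj in vj; have /allPn[i si vi] := negbT vj.
  have ij : i \in args c j by rewrite /args Gj.
  apply: (arm i ij).
    by have := weft_arg_large wf jN ij; rewrite /args Gj in large *; lia.
  move=> os; rewrite (negbTE vi) => h; rewrite knownE // Gj hb /=.
  by apply/orP; right; apply/hasP; exists i.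
have [s Gj] : exists s, G j = Or s by case: (G j) gj => // s; exists s.
rewrite (negbTE hb) val_atE // Gj in vj; have /hasP[i si vi] := vj.
have ij : i \in args c j by rewrite /args Gj.
apply: (arm i ij).
  by have := weft_arg_large wf jN ij; rewrite /args Gj in large *; lia.
move=> os; rewrite vi => h; rewrite knownE // Gj (negbTE hb) /=.
by apply/orP; right; apply/hasP; exists i.
Qed.

Lemma sol_true : circuit_val c sol.
Proof.
have [cl [Oin Ogood OE]] := at_last.
rewrite circuit_val_last.
pose P := [pred j | (weft_at c j <= 1) && (depth_at c j <= d)].
apply: (known_sound wf (X := sol) (os := assume pc cl) (P := P) _ _ (j := N.-1)).
- move=> j i jN ij /andP[wj dj]; have := weft_arg wf jN ij.
  by have := depth_arg wf jN ij; rewrite /P /=; lia.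
- move=> j b jN /andP[wj dj]; rewrite known_assume //.
  exact: lits_true OE Ogood _ _ jN wj dj.
- by have := N_gt0; lia.
- by rewrite /P /= -circuit_weft_last -circuit_depth_last weft_c.
- by case/andP: Ogood => _; rewrite size_map.
Qed.

Lemma sound : weight_satisfiable c k.
Proof.
pose g (i : 'I_k) := vl (at_pos i.+1).
have lt i : (g i).-1 < N.
  by have [v [vN _ E]] := at_mid (ltn_ord i); rewrite /g E.
pose f i : 'I_N := Ordinal (lt i).
have gS i : g i = (f i).+1.
  by have [v [vN _ E]] := at_mid (ltn_ord i); rewrite /= /g E.
have inj : injective f.
  move=> i j fij; have gij : g i = g j by rewrite !gS fij.
  apply: val_inj; case: (ltngtP i j) => // h.
    by have := @vl_mono i.+1 j.+1 h; rewrite -/(g i) -/(g j) gij ltnn;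
      have := ltn_ord j; rewrite /K => ? /(_ ltac:(lia)).
  by have := @vl_mono j.+1 i.+1 h; rewrite -/(g i) -/(g j) gij ltnn;
    have := ltn_ord i; rewrite /K => ? /(_ ltac:(lia)).
exists [set f i | i : 'I_k]; split.
- move=> _ /imsetP[i _ ->] /=.
  by have [v [vN vi E]] := at_mid (ltn_ord i); rewrite /g E.
- by rewrite card_imset // card_ord.
- have eqX : (fun j => j \in [seq val i | i in [set f i | i : 'I_k]]) =1 sol.
    move=> j; apply/imageP/mapP => [[_ /imsetP[i _ ->] ->]|[i]].
      by exists (val i); [rewrite mem_iota /= | rewrite -gS].
    rewrite mem_iota /= add0n => ik E; exists (f (Ordinal ik)).
      by apply/imsetP; exists (Ordinal ik).
    by apply/eqP; rewrite -eqSS -gS E.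
  by rewrite (eq_circuit_val _ eqX) sol_true.
Qed.

End Sound.

(** * From a satisfying set of inputs to a hyperclique *)

Section Complete.

Variable X : {set 'I_N}.
Hypothesis Xin : forall i, i \in X -> is_input (G i).
Hypothesis cardX : #|X| = k.

Let xp (j : nat) : bool := j \in [seq val i | i in X].

Hypothesis Xsat : circuit_val c xp.

Let xs : seq nat := [seq j <- iota 0 N | xp j].

Lemma xs_sorted : sorted ltn xs.
Proof. by apply: sorted_filter; [apply: ltn_trans | apply: iota_ltn_sorted]. Qed.

Lemma mem_xs j : (j \in xs) = xp j.
Proof.
rewrite mem_filter mem_iota /= add0n andb_idr // => /imageP[i _ ->].
exact: ltn_ord.
Qed.

Lemma size_xs : size xs = k.
Proof.
rewrite -cardX cardE -(size_map val); apply/perm_size/uniq_perm.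
- by rewrite filter_uniq ?iota_uniq.
- by rewrite map_inj_uniq ?enum_uniq //; apply: val_inj.
- by move=> j; rewrite mem_xs.
Qed.

Lemma xs_input i : i < k -> is_input (G (nth 0 xs i)) /\ nth 0 xs i < N.
Proof.
move=> ik; have : nth 0 xs i \in xs by rewrite mem_nth ?size_xs.
by rewrite mem_xs => /imageP[j jX ->]; split; [apply: Xin | apply: ltn_ord].
Qed.

Lemma cert_exists : exists cl : seq lit,
  [/\ cl \in lists m (literals N), good_lits pc cl &
      forall l, l \in cl -> l.1 < N /\ val_at c xp l.1 = l.2].
Proof.
have last_lt : N.-1 < N by have := N_gt0; lia.
have [||cl [/andP[s0 sm] hcl _ kcl]] := certificate wf xp (e := d) last_lt.
- by rewrite -circuit_weft_last.
- by rewrite -circuit_depth_last.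
(* [nodes] lists only certificates of exactly [m] literals; repeating the first literal fills up the
   list without changing the set of claims. *)
pose pad := cl ++ nseq (m - size cl) (head (0, true) cl).
have padE : pad =i cl.
  move=> l; rewrite mem_cat mem_nseq; case: (boolP (l \in cl)) => //= lcl.
  apply/negbTE/negP => /andP[_ /eqP e]; move: lcl; rewrite e.
  by case: (cl) s0 => //= a s _; rewrite inE eqxx.
exists pad; split.
- rewrite mem_lists size_cat size_nseq subnKC // eqxx /=; apply/allP => l.
  by rewrite padE /= mem_literals => /hcl[].
- apply/andP; split.
    by apply/allP => l; rewrite padE pcE => /hcl[].
  have := kcl (assume pc pad); rewrite -circuit_val_last // Xsat size_map; apply.
  move=> l lcl; have [l1 _ _] := hcl l lcl; rewrite known_assume // padE.
  by case: l lcl {l1}.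
- by move=> l; rewrite padE => /hcl[].
Qed.

Lemma complete : exists2 Q : {set 'I_(size ns)}, #|Q| = K & hyperclique r L Q.
Proof.
have [cl [clin clgood clval]] := cert_exists.
(* One node for each position. The values of the sentinels on the right exceed every [v.+1] with
   [v < N], which keeps the values strictly increasing. *)
pose y (p : nat) : node :=
  if p == 0 then node0
  else if p <= k then (p, ((nth 0 xs p.-1).+1, [::]))
  else (p, (N.+1 + p, if p == k.+1 + r.+1 then cl else [::])).
have pos_y p : pos (y p) = p.
  by rewrite /y; case: eqP => [->|] //; case: leqP.
have y_ns p : p < K -> y p \in ns.
  rewrite /K /y => pK; case: eqP => [_|/eqP p0]; first exact: mem_head.
  rewrite in_cons; apply/orP; right; rewrite !mem_cat; have [pk|pk] := leqP p k.
    have [vi vN] := @xs_input p.-1 ltac:(lia).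
    apply/orP; left; apply/allpairsP; exists (p.-1, nth 0 xs p.-1) => /=.
    rewrite mem_filter !mem_iota input_atE vi size_map; split=> //; first lia.
    by rewrite prednK // lt0n.
  apply/orP; right; apply/orP; have [->|np] := eqVneq p (k.+1 + r.+1).
    right; apply/mapP; exists cl; last by rewrite size_map.
    by rewrite mem_filter clgood size_map.
  left; apply/mapP; exists (p - k.+1); first by rewrite mem_iota; lia.
  by rewrite size_map subnKC.
have y_mono p q : p < q -> q < K -> vl (y p) < vl (y q).
  rewrite /K => pq qK; rewrite /y; case: (eqVneq q 0) => [|q0]; first lia.
  case: (eqVneq p 0) => [_|p0]; first by rewrite /vl; case: (leqP q k) => _ /=; lia.
  have [qk|qk] := leqP q k.
    rewrite ifT; last lia.
    rewrite /vl /= ltnS; have := xs_sorted => /(sorted_ltn_nth ltn_trans 0).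
    by apply; rewrite ?inE ?size_xs; lia.
  have [pk|pk] := leqP p k; last by rewrite /vl /=; lia.
  by have [_ ] := @xs_input p.-1 ltac:(lia); rewrite /vl /=; lia.
have y_true p j : p < K -> j < N -> vl (y p) = j.+1 -> xp j.
  rewrite /K /y => pK jN; case: eqP => // /eqP p0.
  have [pk|pk] := leqP p k; rewrite /vl /=; last lia.
  by case=> <-; rewrite -mem_xs mem_nth ?size_xs; lia.
have y_onto j : xp j -> exists2 p, p <= k & vl (y p) = j.+1.
  rewrite -mem_xs => /(nthP 0)[i]; rewrite size_xs => ik iE.
  by exists i.+1 => //; rewrite /y /= ik iE.
have idx p (pK : p < K) : index (y p) ns < size ns by rewrite index_mem y_ns.
pose f (p : 'I_K) : 'I_(size ns) := Ordinal (idx p (ltn_ord p)).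
have nth_f p : nth node0 ns (f p) = y p by rewrite /= nth_index // y_ns.
have f_inj : injective f.
  by move=> p q pq; apply: val_inj; rewrite -[LHS]pos_y -[RHS]pos_y -!nth_f pq.
exists [set f p | p : 'I_K]; first by rewrite card_imset // card_ord.
move=> t tU /allP tQ; have tP i : i \in t -> exists p : 'I_K, i = f p.
  by move=> /tQ /imsetP[p _ ->]; exists p.
rewrite mem_filter mem_lists size_map size_tuple eqxx /=; apply/andP; split; last first.
  apply/allP => _ /mapP[i _ ->].
  by have : val i \in iota 0 (size ns) by rewrite mem_iota add0n ltn_ord.
set u := [seq nth _ _ i | i <- _].
have uP w : w \in u -> exists2 p, p < K & w = y p.
  move=> /mapP[_ /mapP[i /tP[p ->] ->] ->].
  by exists p => //; rewrite nth_f.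
apply/andP; split; first (apply/andP; split).
- rewrite uniqbE /u -!map_comp map_inj_in_uniq // => i j /tP[p ->] /tP[q ->] /=.
  by rewrite !nth_index ?y_ns // !pos_y => /val_inj ->.
- apply/allP => w /uP[p pK ->]; apply/allP => w' /uP[q qK ->].
  by rewrite !pos_y -implybE; apply/implyP => pq; apply: y_mono.
apply/allP => w /uP[p pK ->]; apply/allP => l.
rewrite /y /lits; case: eqP => // _; case: leqP => // _ /=; case: eqP => // _ lcl.
(* All information contained in the tuple is true of [xp], so what it forces is true as well and
   cannot contradict a true literal. *)
have [lN lv] := clval l lcl; apply/negP => h.
suff : val_at c xp l.1 = ~~ l.2 by rewrite lv; case: l.2.
apply: (known_sound wf (P := predT) (os := info pc u)) h => // j b jN _.
rewrite known_info // => /andP[ji]; rewrite val_atE //.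
have -> : G j = Input by case: (G j) ji.
case: b => [/hasP[_ /uP[q qK ->] /eqP]|]; first exact: y_true.
(* If [j] were chosen, its position [i] would by monotonicity lie strictly between the consecutive
   positions [q] and [q.+1]. *)
move=> /hasP[_ /uP[q qK ->] /hasP[_ /uP[s sK ->]]].
rewrite !pos_y => /and3P[/eqP -> lt1 lt2]; apply/negbTE/negP => /y_onto[i ik iE].
have iK : i < K by apply: leq_ltn_trans ik _; apply: leq_addr.
rewrite -iE in lt1 lt2.
case: (ltngtP i q) => h; last by rewrite h ltnn in lt1.
  by have := ltn_trans lt1 (y_mono i q h qK); rewrite ltnn.
case: (ltngtP i q.+1) => h'; first by move: h'; rewrite ltnS leqNgt h.
  by have := ltn_trans lt2 (y_mono q.+1 i h' iK); rewrite ltnn.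
by rewrite h' ltnn in lt2.
Qed.

End Complete.

Lemma weight_satisfiableE : weight_satisfiable c k <->
  exists2 Q : {set 'I_(size ns)}, #|Q| = K & hyperclique r L Q.
Proof.
split=> [[X [Xin cardX Xsat]]|[Q cardQ QL]]; first exact: (complete Xin cardX Xsat).
exact: (sound cardQ QL).
Qed.

End Hyperclique.

(** * The reduction is polynomial *)

(* State of the parser: the kind of bit expected next, a number and a list of
   arguments under construction, the kind of the current gate, the gates read. *)
Definition pstate : Type := (nat * (nat * (seq nat * (nat * seq pgate))))%type.

Definition pstate0 (out : seq pgate) : pstate := (0, (0, ([::], (0, out)))).

(** States: 0 before a gate, 1 to 3 within its two tag bits, 4 in the unary argument of a negation,
    5 between the arguments of a conjunction or disjunction, 6 inside one of them, 7 absorbing at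
    the end of the code. *)
Definition parse_step (s : pstate) (b : bool) : pstate :=
  if s.1 == 0 then (if b then 1 else 7, s.2)
  else if s.1 == 1 then (if b then 3 else 2, s.2)
  else if s.1 == 2 then
    if b then (4, s.2) else (0, (0, ([::], (0, rcons s.2.2.2.2 (0, [::])))))
  else if s.1 == 3 then
    (5, (0, ([::], (if b then 3 else 2, s.2.2.2.2))))
  else if s.1 == 4 then
    if b then (4, (s.2.1.+1, s.2.2))
    else (0, (0, ([::], (0, rcons s.2.2.2.2 (1, [:: s.2.1])))))
  else if s.1 == 5 then
    if b then (6, s.2)
    else (0, (0, ([::], (0, rcons s.2.2.2.2 (s.2.2.2.1, s.2.2.1)))))
  else if s.1 == 6 then
    if b then (6, (s.2.1.+1, s.2.2))
    else (5, (0, (rcons s.2.2.1 s.2.1, s.2.2.2)))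
  else s.

Definition parse (x : seq bool) : seq pgate :=
  (foldl parse_step (pstate0 [::]) x).2.2.2.2.

Lemma parse_not n m out x :
  foldl parse_step (4, (n, ([::], (0, out)))) (code_nat m ++ x) =
  foldl parse_step (pstate0 (rcons out (1, [:: n + m]))) x.
Proof.
elim: m n => [|m IH] n; first by rewrite addn0.
by rewrite addnS -addSn -IH.
Qed.

Lemma parse_arg n m s t out x :
  foldl parse_step (6, (n, (s, (t, out)))) (code_nat m ++ x) =
  foldl parse_step (5, (0, (rcons s (n + m), (t, out)))) x.
Proof.
elim: m n => [|m IH] n; first by rewrite addn0.
by rewrite addnS -addSn -IH.
Qed.

Lemma parse_args s s' t out x :
  foldl parse_step (5, (0, (s, (t, out)))) (code_seq code_nat s' ++ x) =
  foldl parse_step (pstate0 (rcons out (t, s ++ s'))) x.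
Proof.
rewrite /code_seq; elim: s' s => [|i s' IH] s; first by rewrite cats0.
by rewrite /= rcons_cat -catA parse_arg IH add0n cat_rcons.
Qed.

Lemma parse_gate g out x :
  foldl parse_step (pstate0 out) (true :: code_gate g ++ x) =
  foldl parse_step (pstate0 (rcons out (gcode g))) x.
Proof.
by case: g => [|i|s|s] //=; rewrite ?parse_not ?parse_args.
Qed.

Lemma parseK c : parse (code_circuit c) = map gcode c.
Proof.
suff main out : foldl parse_step (pstate0 out) (code_circuit c) =
    (7, (0, ([::], (0, out ++ map gcode c)))) by rewrite /parse main.
rewrite /code_circuit /code_seq; elim: c out => [|g c IH] out.
  by rewrite cats0.
rewrite /= rcons_cat; have := parse_gate g out => /= ->.
by rewrite IH cat_rcons.
Qed.

Ltac fp_hook ::= idtac.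

Lemma FP_parse_step : FP (fun x : pstate * bool => parse_step x.1 x.2).
Proof. rewrite /parse_step; fp. Qed.

Lemma FP_parse : FP parse.
Proof.
apply: FP_snd; do 3 apply: FP_snd.
(* One bit adds a bounded number of cells to the state, since finished numbers and lists only move
   from one field to another; 20 is a generous bound. *)
apply: (FP_foldl (E := seq bool) (h := fun=> parse_step) (G := fun=> 20)).
- apply: (FP_comp2 (h := parse_step)) FP_parse_step _ _; fp.
- exact: FP_cst.
- exact: FP_id.
- exact: polyb_cst.
move=> _ [md [cur [ar [tg out]]]] b; rewrite /parse_step /=.
by repeat case: ifP => _; rewrite !(esz_pair, esz_rcons, esz_nat) /=;
  rewrite ?(esz_pair, esz_rcons, esz_cons, esz_nil, esz_nat) /=; lia.
Qed.

Ltac fp_hook ::= lazymatch goal with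
  | |- FP (fun e => parse (@?f e)) => apply: (FP_comp (f := f) FP_parse)
  end.

Lemma FP_kgate : FP (fun x : seq (bool * bool) * pgate => kgate x.1 x.2).
Proof. rewrite /kgate; fp. Qed.

Ltac fp_hook ::= lazymatch goal with
  | |- FP (fun e => kgate (@?f e) (@?g e)) =>
      apply: (FP_comp2 (f := f) (g := g) FP_kgate)
  end.

Lemma FP_keval : FP (fun x : seq (bool * bool) * seq pgate => keval x.1 x.2).
Proof.
apply: (FP_foldl (h := fun x vs g => rcons vs (kstep x.1 vs g)) (G := fun=> 4)).
- rewrite /kstep; fp.
- fp.
- fp.
- exact: polyb_cst.
move=> [os pc] vs g; rewrite esz_rcons esz_pair !esz_bool /=.
by case: (_ || _); case: (_ || _); lia.
Qed.

Ltac fp_hook ::= lazymatch goal with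
  | |- FP (fun e => keval (@?f e) (@?g e)) =>
      apply: (FP_comp2 (f := f) (g := g) FP_keval)
  end.

Lemma FP_info : FP (fun x : seq pgate * seq node => info x.1 x.2).
Proof. rewrite /info /says_true /says_false /input_at /vl /pos; fp. Qed.

Ltac fp_hook ::= lazymatch goal with
  | |- FP (fun e => keval (@?f e) (@?g e)) =>
      apply: (FP_comp2 (f := f) (g := g) FP_keval)
  | |- FP (fun e => info (@?f e) (@?g e)) =>
      apply: (FP_comp2 (f := f) (g := g) FP_info)
  end.

Lemma FP_tuple_ok : FP (fun x : seq pgate * seq node => tuple_ok x.1 x.2).
Proof. rewrite /tuple_ok /lits_ok /uniqb /known /vl /pos /lits; fp. Qed.

Lemma FP_good_lits : FP (fun x : seq pgate * seq lit => good_lits x.1 x.2).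
Proof. rewrite /good_lits /assume /lit_ok; fp. Qed.

(** The length [m] is not part of the input: induction on it builds one program for each [m], with a
    polynomial whose degree depends on [m]. *)
Lemma FP_lists A {eA : Enc A} m : FP (fun s : seq A => lists m s).
Proof.
elim: m => [|m IH] /=; first exact: FP_cst.
by fp; apply: (FP_comp (f := fst) IH); fp.
Qed.

Ltac fp_hook ::= lazymatch goal with
  | |- FP (fun e => tuple_ok (@?f e) (@?g e)) =>
      apply: (FP_comp2 (f := f) (g := g) FP_tuple_ok)
  | |- FP (fun e => good_lits (@?f e) (@?g e)) =>
      apply: (FP_comp2 (f := f) (g := g) FP_good_lits)
  | |- FP (fun e => lists ?m (@?f e)) => apply: (FP_comp (f := f) (FP_lists m))
  end.

Lemma FP_nodes m r : FP (fun x : seq pgate * nat => nodes m r x.1 x.2).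
Proof. rewrite /nodes /literals /input_at; fp. Qed.

Ltac fp_hook ::= lazymatch goal with
  | |- FP (fun e => tuple_ok (@?f e) (@?g e)) =>
      apply: (FP_comp2 (f := f) (g := g) FP_tuple_ok)
  | |- FP (fun e => lists ?m (@?f e)) => apply: (FP_comp (f := f) (FP_lists m))
  | |- FP (fun e => nodes ?m ?r (@?f e) (@?g e)) =>
      apply: (FP_comp2 (f := f) (g := g) (FP_nodes m r))
  end.

Lemma FP_tuples m r : FP (fun x : seq pgate * nat => tuples m r x.1 x.2).
Proof. rewrite /tuples; fp. Qed.

Lemma FP_graph_bits :
  FP (fun x : seq (nat * nat) * nat => graph_bits x.1 x.2).
Proof.
rewrite /graph_bits /code_nat /code_adj /code_start; fp.
Qed.

Ltac fp_hook ::= lazymatch goal with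
  | |- FP (fun e => graph_bits (@?f e) (@?g e)) =>
      apply: (FP_comp2 (f := f) (g := g) FP_graph_bits)
  end.

(** The number [K ^_ r] of padding vertices, up to lower terms, is polynomial in the unary [K]
    because the exponent [r] is not part of the input. *)
Lemma FP_instance_bits r :
  FP (fun x : (nat * nat) * seq (seq nat) => instance_bits x.1.1 r x.1.2 x.2).
Proof.
rewrite /instance_bits /subdiv_codes /link; fp.
Qed.

Lemma FP_budget r : FP (fun n : nat => budget r n).
Proof. rewrite /budget; fp. Qed.

Section Reduction.

Variable d : nat.

Let m := 2 ^ d.
Let r := (2 * m).+1.

Definition red_budget (k : nat) : nat := budget r (k.+1 + r.+1.+1).

Definition red (x : seq bool * nat) : seq bool * nat :=
  (instance_bits (size (nodes m r (parse x.1) x.2)) r (x.2.+1 + r.+1.+1)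
     (tuples m r (parse x.1) x.2),
   red_budget x.2).

Lemma FP_red_budget : FP red_budget.
Proof.
apply: (FP_comp (g := budget r)); first exact: FP_budget.
fp.
Qed.

Lemma FP_red : FP red.
Proof.
have h : FP (fun x : seq bool * nat => (parse x.1, x.2)).
  by apply: FP_pair; [apply: (FP_comp (f := fst) FP_parse) |]; fp.
have hn := FP_comp (FP_nodes m r) h; have ht := FP_comp (FP_tuples m r) h.
apply: FP_pair; last by apply: (FP_comp (f := snd) FP_red_budget); fp.
apply: (FP_comp (f := fun x : seq bool * nat =>
  ((size (nodes m r (parse x.1) x.2), x.2.+1 + r.+1.+1), tuples m r (parse x.1) x.2))
  (FP_instance_bits r)).
apply: FP_pair => //; apply: FP_pair; last by fp.
exact: FP_sizes hn.
Qed.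

Lemma red_correct c k : circuit_wf c -> circuit_weft c <= 1 ->
  circuit_depth c <= d ->
  is_instance (LS_vertex_cover two_subdivided) (red (code_circuit c, k)).1
    (red (code_circuit c, k)).2 /\
  (is_yes (LS_vertex_cover two_subdivided) (red (code_circuit c, k)).1
    (red (code_circuit c, k)).2 <-> weight_satisfiable c k).
Proof.
move=> wf wc dc; rewrite /red -[(_, k).1]/(code_circuit c) parseK.
have m0 : 0 < m by rewrite expn_gt0.
have r1 : 1 < r by rewrite /r; lia.
have rK : r < k.+1 + r.+1.+1 by lia.
have tU := tuples_uniq m r (map gcode c) k.
have tP := @tuplesP m r (map gcode c) k.
split; first exact: instance_ok.
rewrite (weight_satisfiableE k wf wc dc).
exact: (instance_yes r1 rK tU tP).
Qed.

End Reduction.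

(** * Composition with an arbitrary reduction to weighted circuit satisfiability *)

(** The parser inverts the code up to [gcode], which is injective. Thus the circuit behind [is_yes]
    is the one that witnesses [is_instance]. *)
Lemma code_circuit_inj : injective code_circuit.
Proof.
have inj : injective gcode by move=> [|i|s|s] [|j|s'|s'] //= [->].
by move=> c c' /(congr1 parse); rewrite !parseK => /(inj_map inj).
Qed.

Lemma depth_tree_of_nat n : depth (tree_of_nat n) = n.
Proof. by elim: n => //= n ->; rewrite max0n. Qed.

Lemma depth_tree_of_bits x : size x <= depth (tree_of_bits x) <= (size x).+1.
Proof.
elim: x => //= b x IH; case: b => /=; lia.
Qed.

Lemma esz_bits (x : seq bool) : esz x <= 2 * size x.
Proof. by elim: x => // b x IH; rewrite esz_cons esz_bool /=; case: b; lia. Qed.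

(** [computable] carries no time bound, so [f] need not satisfy [FP]; the programs are composed
    directly, with a copy of [n] kept aside. *)
Lemma computable_comp f (h : nat * nat -> nat) :
  computable f -> FP h -> computable (fun n => h (f n, n)).
Proof.
move=> [p hp] hh; have [q [T [hq _ _]]] := hh.
have [p' hp'] := runs_clean p; have [i [I [hi _ _]]] := FP_id (A := nat).
exists (Seq (pair_cmd p' i) q) => n.
have [t /hp' ht] := hp n; have [u _ hu] := hi n; have [v _ hv] := hq (f n, n).
by eexists; exists (st (enc (h (f n, n)))); first exact: ExecSeq (exec_pair ht hu) hv.
Qed.

Lemma computable_poly f c : computable f -> computable (fun n => (f n + n + 2) ^ c).
Proof.
move=> hf; apply: (computable_comp (h := fun p => (p.1 + p.2 + 2) ^ c)) hf _.
elim: c => [|c IH]; first exact: FP_cst.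
apply: (FP_ext (g := fun p => (p.1 + p.2 + 2) * (p.1 + p.2 + 2) ^ c)).
  by move=> p; rewrite expnS.
by apply: FP_muln => //; fp.
Qed.

(** The length of a bit list and the value of a unary number are bounded by the depth of their
    trees, which is linear in the depth of the input and the time. *)
Lemma runs_depth p : exists C, forall x k t x' k',
  runs p (tree_of_instance x k) t (tree_of_instance x' k') ->
  size x' + k' <= C * (size x + k + t).+1.
Proof.
exists (2 * (cmd_depth p).+2) => x k t x' k' [s hs s0].
have h0 v : depth (update (fun=> Nil) 0 (tree_of_instance x k) v) <= (size x + k).+2.
  rewrite /update; case: eqP => //= _; have := depth_tree_of_bits x.
  by rewrite depth_tree_of_nat; lia.
have := depth_exec hs (leqnn _) h0 0; rewrite s0 /=.
have := depth_tree_of_bits x'; rewrite depth_tree_of_nat; nia.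
Qed.

(** In the application [Z] is the product of [f k + k + 2] and [(size x).+1]. Everything is pushed
    below one power of [Z], which then splits into the parameter factor and the length factor of
    [fpt_reduces]. *)
Lemma time_bound Z C a b e n t u :
  1 < Z -> n < Z -> t <= Z ^ a.+1 -> u <= C * (n + t).+1 ->
  t + b + (2 * u + 3) ^ e <= Z ^ (a.+1 + b + (4 * C + a + 4) * e + 2).
Proof.
move=> Z1 nZ tZ uC.
have le_exp i : i <= Z ^ i by apply: ltnW; apply: ltn_expl.
have mono i j : i <= j -> Z ^ i <= Z ^ j by move=> ij; rewrite leq_exp2l.
have hu : 2 * u + 3 <= Z ^ (4 * C + a + 4).
  have ZZ : Z <= Z ^ a.+1 by rewrite -{1}[Z]expn1 mono.
  have : 2 * u + 3 <= (4 * C + 3) * Z ^ a.+1.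
    by have : C * (n + t).+1 <= C * (2 * Z ^ a.+1); [rewrite leq_mul2l; lia | nia].
  move=> h; apply: leq_trans h _.
  have -> : 4 * C + a + 4 = (4 * C + 3) + a.+1 by lia.
  by rewrite expnD leq_mul.
have hv : (2 * u + 3) ^ e <= Z ^ ((4 * C + a + 4) * e).
  by rewrite expnM; apply: leq_base_exp.
set c := a.+1 + b + (4 * C + a + 4) * e; rewrite expnD.
have h1 : t <= Z ^ c by apply: leq_trans tZ _; apply: mono; rewrite /c; lia.
have h2 : b <= Z ^ c by apply: leq_trans (le_exp b) _; apply: mono; rewrite /c; lia.
have h3 : (2 * u + 3) ^ e <= Z ^ c by apply: leq_trans hv _; apply: mono; rewrite /c; lia.
have h4 : 2 ^ 2 <= Z ^ 2 by rewrite leq_exp2r.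
move: h1 h2 h3 h4; move: (Z ^ c) (Z ^ 2) ((2 * u + 3) ^ e) => X Y W; nia.
Qed.

Theorem theorem2 : W_hard 1 (LS_vertex_cover two_subdivided).
Proof.
move=> A [d [p [f [g [a [cf cg H]]]]]].
have [p' hp'] := runs_clean p.
have [C hC] := runs_depth p.
(* The depth bound [d] is fixed by the problem [A], so the arity of the hyperclique problem and the
   exponent [e] are constants. *)
have [q [T [hq [e hT] _]]] := FP_red d.
have [e2 hg] := FP_size (FP_red_budget d).
(* The cost of clearing the variables left over by the given reduction. *)
pose b := (assigned p).+1.
pose c := a.+1 + b + (4 * C + a + 4) * e + 2.
exists (Seq p' q), (fun k => (f k + k + 2) ^ c), (fun k => (g k + k + 2) ^ e2), c.
split; [exact: computable_poly | exact: computable_poly | move=> x k xk].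
have [x' [k' [t [hrun ht hk [ci x'E [wf wc dc]] hyes]]]] := H x k xk.
have [u hu eu] := hq (x', k').
have [inst yesE] := red_correct k' wf wc dc; rewrite -x'E in inst yesE.
exists (red d (x', k')).1, (red d (x', k')).2, (t + b + u); split.
- exists (st (enc (red d (x', k')))) => //.
  exact: ExecSeq (hp' _ _ _ hrun) eu.
- rewrite -expnMn; apply: leq_trans (_ : t + b + (2 * (size x' + k') + 3) ^ e <= _).
    rewrite leq_add2l; apply: leq_trans hu _; apply: leq_trans (hT _) _.
    apply: leq_base_exp; rewrite esz_pair esz_nat /=; have := esz_bits x'; lia.
  apply: time_bound (hC _ _ _ _ _ hrun).
  + by nia.
  + by nia.
  + apply: leq_trans ht _; rewrite expnMn; apply: leq_mul.
      by rewrite -{1}[f k]expn1; apply: leq_trans (leq_base_exp 1 _) (leq_pexp2l _ _); lia.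
    by rewrite leq_pexp2l.
- apply: leq_trans (_ : (k' + 2) ^ e2 <= _).
    by have := hg k'; rewrite !esz_nat.
  by apply: leq_base_exp; lia.
- exact: inst.
- rewrite hyes yesE; split=> [[c2 c2E]|ws]; last by exists ci.
  by rewrite -(_ : c2 = ci) //; apply: code_circuit_inj; rewrite -c2E.
Qed.
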